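(* Let $\mathsf{AffHS}$ be the symmetric two-coloured operad (colours $\mathfrak g$, $\mathfrak h$) generated by a unary operation $i:\mathfrak g\to\mathfrak h$, a skew-symmetric operation $\beta:\mathfrak g\otimes\mathfrak g\to\mathfrak g$ and an operation $m:\mathfrak g\otimes\mathfrak h\to\mathfrak h$ (no symmetry), subject to the relations $$\beta(\beta(x_1,x_2),x_3)-\beta(\beta(x_1,x_3),x_2)-\beta(x_1,\beta(x_2,x_3))=0,$$ $$m(\beta(x_1,x_2),x_3)+m(x_1,m(x_2,x_3))-m(x_2,m(x_1,x_3))=0,$$ $$i(\beta(x_1,x_2))+m(x_1,i(x_2))-m(x_2,i(x_1))=0.$$ Then the associated shuffle two-coloured operad, with generators $i,\beta,m$ and $n$, where $n(x_1,x_2)=m(x_2,x_1)$, admits a quadratic Gröbner basis of its ideal of relations with respect to the QM-ordering described in the context.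
   Context: Work over a field $\Bbbk$ of characteristic $0$. Let $I$ be a finite set of colours. A symmetric $I$-coloured operad $P$ consists of finite-dimensional spaces $P(n,\chi,c)$ for $n\ge 1$, $\chi:\{1,\dots,n\}\to I$ (input colours), $c\in I$ (output colour), with symmetric group actions $\sigma:P(n,\chi,c)\to P(n,\chi\sigma,c)$, partial compositions $\circ_l$ defined when the colour of the $l$-th input equals the output colour of the inserted operation, and identities $\mathrm{id}_c$, satisfying the usual operad axioms. Free shuffle coloured operad. Given generators, each with an arity, an ordered list of input colours and an output colour, the free shuffle $I$-coloured operad has as basis the tree monomials: planar rooted trees with vertices labelled by generators, edge colours matching the input/output colours of the generators, and leaves labelled bijectively by $1,\dots,n$ so that at every vertex the smallest leaf labels of the subtrees above its inputs increase from left to right. Shuffle compositions $\alpha\circ_{l,\omega}\beta$ graft $\beta$ on the leaf $l$ of $\alpha$ (colours matching) and relabel the leaves by $\omega$, preserving the relative orders of labels coming from $\alpha$ and from $\beta$, so that the result is again a shuffle tree. An operadic ideal is a collection of subspaces, one for each arity, input colouring and output colour, closed under compositions with arbitrary elements on either side. A symmetric operad given by generators and relations yields a shuffle operad: its generators are all generators together with a basis of their symmetric group orbits, and its relations are all elements of the symmetric group orbits of the relations, rewritten as combinations of shuffle tree monomials. An ordering of tree monomials is admissible if monomials of smaller arity are smaller and $\alpha\le\alpha'$, $\beta\le\beta'$ (with $\alpha,\alpha'$ of the same arity and $\beta,\beta'$ of the same arity) imply $\alpha\circ_{l,\omega}\beta\le\alpha'\circ_{l,\omega}\beta'$ for all possible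 compositions. QM-ordering for $\mathsf{AffHS}$: consider the algebra generated by $m,n,\beta,i,q$ with $q$ central and $\beta m=m\beta q$, $\beta n=n\beta q$, $im=miq$, $in=niq$. Every word in $m,n,\beta,i$ has a normal form $w_{m,n}\,w_{\beta,i}\,q^{d_q}$, with $w_{m,n}$ a word in $m,n$ of length $d_x$ and $w_{\beta,i}$ a word in $\beta,i$ of length $d_y$. To compare two words: the one with greater $d_x$ is smaller; if $d_x$ are equal, compare the $(m,n)$-words lexicographically; if equal, the one with greater $d_y$ is greater; if equal, compare the $(\beta,i)$-words lexicographically; if equal, the one with greater $d_q$ is greater. (Lexicographic comparisons use arbitrary fixed orders on $\{m,n\}$ and on $\{\beta,i\}$.) To compare tree monomials, compare arities first (smaller arity is smaller); for equal arity $k$ compare the vectors $(a_1,\dots,a_k)$, where $a_j$ is the word of vertex labels on the path from the root to leaf $j$, component by component using this comparison of words. This is a partial ordering; any extension of it to an admissible total ordering may be used. Gröbner bases: the leading term of an element is its largest tree monomial. For a subtree (containing all edges adjacent to its vertices) of a tree monomial, its leaves are relabelled according to the order of the smallest leaf labels above them; $\alpha$ is divisible by $\beta$ if $\beta$ arises in this way from a subtree of $\alpha$. A generating set $G$ of an operadic ideal $M$ is a Gröbner basis if the leading term of every nonzero $f\in M$ is divisible by the leading term of some element of $G$. It is quadratic if all its elements are combinations of tree monomials with two vertices. *)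

(* Defs.v *)
From HB Require Import structures.
From mathcomp Require Import all_boot all_order all_algebra.
From mathcomp Require Import finmap.
From mathcomp Require Import monalg.

Set Implicit Arguments.
Unset Strict Implicit.
Unset Printing Implicit Defensive.

Import GRing.Theory.
Local Open Scope nat_scope.
Local Open Scope ring_scope.

(** * Free shuffle coloured operads *)

Record signature := Signature {
  colour : finType;
  gen : finType;
  gin : gen -> seq colour;
  gout : gen -> colour;
  gin_neq0 : forall g, gin g != [::]
}.

Inductive tree (S : signature) : Type :=
| Leaf of colour S & nat
| Node of gen S & seq (tree S).

Arguments Leaf {S}.
Arguments Node {S}.

Section TreeChoice.
Variable S : signature.

Lemma tree_nested_ind (P : tree S -> Prop) :
    (forall c j, P (Leaf c j)) ->
    (forall g ts, foldr (fun t Q => P t /\ Q) True ts -> P (Node g ts)) ->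
  forall t, P t.
Proof.
move=> PL PN; fix IH 1 => -[c j|g ts]; first exact: PL.
by apply: PN; elim: ts => //= t ts; split.
Qed.

Fixpoint tree_encode (t : tree S) : GenTree.tree (gen S + colour S * nat) :=
  match t with
  | Leaf c j => GenTree.Leaf (inr (c, j))
  | Node g ts => GenTree.Node 0 (GenTree.Leaf (inl g) :: map tree_encode ts)
  end.

Fixpoint tree_decode (u : GenTree.tree (gen S + colour S * nat)) :
    option (tree S) :=
  match u with
  | GenTree.Leaf (inr (c, j)) => Some (Leaf c j)
  | GenTree.Node _ (GenTree.Leaf (inl g) :: us) =>
      Some (Node g (pmap tree_decode us))
  | _ => None
  end.

Lemma tree_encodeK : pcancel tree_encode tree_decode.
Proof.
elim/tree_nested_ind=> //= g ts IH; congr (Some (Node g _)).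
by elim: ts IH => //= t ts IHts [-> /IHts ->].
Qed.

HB.instance Definition _ := Choice.copy (tree S) (pcan_type tree_encodeK).

End TreeChoice.

Section ShuffleTrees.
Variable S : signature.
Implicit Types (t a b : tree S) (c : colour S) (chi : seq (colour S)).

Definition tout t : colour S :=
  match t with Leaf c _ => c | Node g _ => gout g end.

Fixpoint leaves t : seq (colour S * nat) :=
  match t with
  | Leaf c j => [:: (c, j)]
  | Node _ ts => flatten (map leaves ts)
  end.

Definition labels t : seq nat := map snd (leaves t).
Definition arity t : nat := size (leaves t).
Definition minlab t : nat := foldr minn (head 0%N (labels t)) (labels t).

Fixpoint nvertices t : nat :=
  match t with
  | Leaf _ _ => 0
  | Node _ ts => (sumn (map nvertices ts)).+1
  end.

Fixpoint coloured t : bool :=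
  match t with
  | Leaf _ _ => true
  | Node g ts => (map tout ts == gin g) && all coloured ts
  end.

Fixpoint shuffled t : bool :=
  match t with
  | Leaf _ _ => true
  | Node _ ts => sorted ltn (map minlab ts) && all shuffled ts
  end.

Definition tree_monomial t : bool :=
  [&& coloured t, shuffled t & perm_eq (labels t) (iota 1 (arity t))].

(* An input colouring of arity n is a sequence chi of length n, whose first
   entry is the colour of the input labelled 1. *)
Definition inputs chi : seq (colour S * nat) := zip chi (iota 1 (size chi)).

Definition monomial_in chi c t : bool :=
  [&& tree_monomial t, perm_eq (leaves t) (inputs chi) & tout t == c].

Fixpoint graft (sigma : colour S -> nat -> tree S) t : tree S :=
  match t with
  | Leaf c j => sigma c j
  | Node g ts => Node g (map (graft sigma) ts)
  end.

Definition relabel (f : nat -> nat) : tree S -> tree S :=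
  graft (fun c j => Leaf c (f j)).

(* The relabelling omega of a shuffle composition of an element of arity p with
   an element of arity q grafted on the leaf l is given by the new labels f and
   g of the leaves of the two factors.  Both are increasing; the leaf l itself
   disappears, and f l stands for the smallest label of what is grafted on it. *)
Definition shuffle_relabelling (p q l : nat) (f g : nat -> nat) : bool :=
  [&& l \in iota 1 p,
      sorted ltn (map f (iota 1 p)), sorted ltn (map g (iota 1 q)),
      f l == g 1%N
    & perm_eq (map f (rem l (iota 1 p)) ++ map g (iota 1 q))
              (iota 1 (p + q).-1)].

Definition tcompose (l : nat) (f g : nat -> nat) a b : tree S :=
  graft (fun c j => if j == l then relabel g b else Leaf c (f j)) a.

Definition tcomposable (l : nat) (f g : nat -> nat) a b : bool :=
  ((tout b, l) \in leaves a) && shuffle_relabelling (arity a) (arity b) l f g.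

Fixpoint subtrees t : seq (tree S) :=
  t :: match t with
       | Leaf _ _ => [::]
       | Node _ ts => flatten (map subtrees ts)
       end.

(* sigma j is what lies above the j-th leaf of the occurrence of b in a. *)
Definition divides b a : Prop :=
  exists u (sigma : nat -> tree S),
    [/\ u \in subtrees a,
        u = graft (fun _ j => sigma j) b,
        all (fun x => tout (sigma x.2) == x.1) (leaves b)
      & sorted ltn (map (minlab \o sigma) (iota 1 (arity b)))].

(** ** Orderings of tree monomials *)

Definition total_order_on (T : eqType) (D : pred T) (le : rel T) : Prop :=
  [/\ {in D, reflexive le}, {in D &, antisymmetric le},
      {in D & &, transitive le} & {in D &, total le}].

Record admissible (le : rel (tree S)) : Prop := Admissible {
  admissible_total : total_order_on tree_monomial le;
  admissible_arity : forall s t, tree_monomial s -> tree_monomial t ->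
    (arity s < arity t)%N -> le s t && (s != t);
  admissible_compose : forall l f g a a' b b',
    tree_monomial a -> tree_monomial a' ->
    tree_monomial b -> tree_monomial b' ->
    arity a = arity a' -> arity b = arity b' ->
    le a a' -> le b b' ->
    tcomposable l f g a b -> tcomposable l f g a' b' ->
    le (tcompose l f g a b) (tcompose l f g a' b')
}.

End ShuffleTrees.

(** ** Linear combinations, ideals and Groebner bases *)

Section Ideals.
Variables (k : fieldType) (S : signature).
Local Notation elt := {malg k[tree S]}.
Implicit Types (x y : elt) (c : colour S) (chi : seq (colour S)).

Definition homogeneous chi c x : Prop :=
  forall t, t \in msupp x -> monomial_in chi c t.

Definition mcompose (l : nat) (f g : nat -> nat) x y : elt :=
  \sum_(a <- msupp x) \sum_(b <- msupp y)
    << x@_a * y@_b *g tcompose l f g a b >>.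

(* chi is the input colouring of the composition of an element with input
   colouring chi1 with an element with input colouring chi2 and output c2. *)
Definition composable (l : nat) (f g : nat -> nat) chi1 chi2 c2 chi : bool :=
  [&& (c2, l) \in inputs chi1,
      shuffle_relabelling (size chi1) (size chi2) l f g
    & perm_eq ([seq (z.1, f z.2) | z <- rem (c2, l) (inputs chi1)]
                 ++ [seq (z.1, g z.2) | z <- inputs chi2])
              (inputs chi)].

Inductive ideal_gen (R : elt -> Prop) :
    seq (colour S) -> colour S -> elt -> Prop :=
| ideal_gen_base chi c x :
    R x -> homogeneous chi c x -> ideal_gen R chi c x
| ideal_gen_zero chi c : ideal_gen R chi c 0
| ideal_gen_lin chi c (r : k) x y :
    ideal_gen R chi c x -> ideal_gen R chi c y ->
    ideal_gen R chi c (r *: x + y)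
| ideal_gen_compl l f g chi1 c1 chi2 c2 chi x y :
    ideal_gen R chi1 c1 x -> homogeneous chi2 c2 y ->
    composable l f g chi1 chi2 c2 chi ->
    ideal_gen R chi c1 (mcompose l f g x y)
| ideal_gen_compr l f g chi1 c1 chi2 c2 chi x y :
    homogeneous chi1 c1 x -> ideal_gen R chi2 c2 y ->
    composable l f g chi1 chi2 c2 chi ->
    ideal_gen R chi c1 (mcompose l f g x y).

Definition leading (le : rel (tree S)) x (t : tree S) : Prop :=
  t \in msupp x /\ forall s, s \in msupp x -> le s t.

Definition generates (G : elt -> Prop)
    (M : seq (colour S) -> colour S -> elt -> Prop) : Prop :=
  (forall x, G x -> exists chi c, M chi c x) /\
  (forall chi c x, M chi c x <-> ideal_gen G chi c x).

Definition groebner_basis (le : rel (tree S))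
    (M : seq (colour S) -> colour S -> elt -> Prop) (G : elt -> Prop) : Prop :=
  generates G M /\
  forall chi c x t, M chi c x -> x != 0 -> leading le x t ->
    exists y s, [/\ G y, leading le y s & divides s t].

Definition quadratic (G : elt -> Prop) : Prop :=
  forall x, G x -> forall t, t \in msupp x -> nvertices t = 2%N.

End Ideals.

(** * The operad AffHS *)

Inductive affcol := Cg | Ch.

Definition bool_of_affcol c := if c is Cg then true else false.
Definition affcol_of_bool (b : bool) := if b then Cg else Ch.
Lemma bool_of_affcolK : cancel bool_of_affcol affcol_of_bool.
Proof. by case. Qed.
HB.instance Definition _ := Finite.copy affcol (can_type bool_of_affcolK).

Inductive affgen := Gi | Gbeta | Gm | Gn.

Definition code_of_affgen g : bool * bool :=
  match g with
  | Gi => (false, false) | Gbeta => (false, true)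
  | Gm => (true, false) | Gn => (true, true)
  end.
Definition affgen_of_code (b : bool * bool) :=
  if b.1 then if b.2 then Gn else Gm else if b.2 then Gbeta else Gi.
Lemma code_of_affgenK : cancel code_of_affgen affgen_of_code.
Proof. by case. Qed.
HB.instance Definition _ := Finite.copy affgen (can_type code_of_affgenK).

Definition affin g : seq affcol :=
  match g with
  | Gi => [:: Cg] | Gbeta => [:: Cg; Cg]
  | Gm => [:: Cg; Ch] | Gn => [:: Ch; Cg]
  end.

Definition affout g : affcol :=
  match g with Gbeta => Cg | _ => Ch end.

Lemma affin_neq0 g : affin g != [::].
Proof. by case: g. Qed.

Definition AffHS_sig : signature := Signature affout affin_neq0.

(* Terms in the generators of the symmetric operad; X c j is the input x_j of
   colour c. *)
Inductive term :=
| X of affcol & nat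
| I_ of term
| Beta of term & term
| M_ of term & term.

(* A symmetric operation as a sign and a shuffle tree monomial: the arguments
   are put in increasing order of smallest labels by means of
   beta(x1,x2) = - beta(x2,x1) and m(x1,x2) = n(x2,x1). *)
Fixpoint straighten (u : term) : bool * tree AffHS_sig :=
  match u with
  | X c j => (false, @Leaf AffHS_sig c j)
  | I_ v => let: (e, t) := straighten v in (e, @Node AffHS_sig Gi [:: t])
  | Beta v1 v2 =>
      let: (e1, t1) := straighten v1 in
      let: (e2, t2) := straighten v2 in
      if (minlab t1 < minlab t2)%N
      then (e1 (+) e2, @Node AffHS_sig Gbeta [:: t1; t2])
      else (~~ (e1 (+) e2), @Node AffHS_sig Gbeta [:: t2; t1])
  | M_ v1 v2 =>
      let: (e1, t1) := straighten v1 in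
      let: (e2, t2) := straighten v2 in
      if (minlab t1 < minlab t2)%N
      then (e1 (+) e2, @Node AffHS_sig Gm [:: t1; t2])
      else (e1 (+) e2, @Node AffHS_sig Gn [:: t2; t1])
  end.

Section AffHSRelations.
Variable k : fieldType.

Definition sh (u : term) : {malg k[tree AffHS_sig]} :=
  << (-1) ^+ (straighten u).1 *g (straighten u).2 >>.

Definition rel_lie (x1 x2 x3 : term) :=
  sh (Beta (Beta x1 x2) x3) - sh (Beta (Beta x1 x3) x2)
  - sh (Beta x1 (Beta x2 x3)).

Definition rel_act (x1 x2 x3 : term) :=
  sh (M_ (Beta x1 x2) x3) + sh (M_ x1 (M_ x2 x3)) - sh (M_ x2 (M_ x1 x3)).

Definition rel_aff (x1 x2 : term) :=
  sh (I_ (Beta x1 x2)) + sh (M_ x1 (I_ x2)) - sh (M_ x2 (I_ x1)).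

(* The three symmetric group orbits of relations, in shuffle form. *)
Inductive AffHS_relation : {malg k[tree AffHS_sig]} -> Prop :=
| AffHS_lie (s : nat -> nat) :
    perm_eq (map s (iota 1 3)) (iota 1 3) ->
    AffHS_relation (rel_lie (X Cg (s 1)) (X Cg (s 2)) (X Cg (s 3)))
| AffHS_act (s : nat -> nat) :
    perm_eq (map s (iota 1 3)) (iota 1 3) ->
    AffHS_relation (rel_act (X Cg (s 1)) (X Cg (s 2)) (X Ch (s 3)))
| AffHS_aff (s : nat -> nat) :
    perm_eq (map s (iota 1 2)) (iota 1 2) ->
    AffHS_relation (rel_aff (X Cg (s 1)) (X Cg (s 2))).

Definition AffHS_ideal := ideal_gen AffHS_relation.

End AffHSRelations.

(** * The QM-ordering *)

Definition in_mn (g : affgen) : bool := (g == Gm) || (g == Gn).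
Definition in_bi (g : affgen) : bool := (g == Gbeta) || (g == Gi).

(* The normal form w_mn w_bi q^d of a word: the letters m, n are moved to the
   left of the letters beta, i, each exchange producing one factor q. *)
Definition word_mn (w : seq affgen) := filter in_mn w.
Definition word_bi (w : seq affgen) := filter in_bi w.

Fixpoint word_q (w : seq affgen) : nat :=
  if w is g :: w' then ((if in_bi g then count in_mn w' else 0) + word_q w')%N
  else 0%N.

Definition word_nf (w : seq affgen) := (word_mn w, word_bi w, word_q w).

Lemma word_nf_exchange u y x v : in_bi y -> in_mn x ->
  word_nf (u ++ [:: y, x & v]) =
  ((word_nf (u ++ [:: x, y & v])).1, (word_nf (u ++ [:: x, y & v])).2.+1).
Proof.
move=> hy hx.
have /negbTE nx : ~~ in_bi x by case: x hx.
have /negbTE ny : ~~ in_mn y by case: y hy.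
rewrite /word_nf /word_mn /word_bi !filter_cat /= hx hy nx ny.
congr (_, _, _); elim: u => [|z u IH] /=.
  by rewrite hx hy nx; reflexivity.
by case: (in_bi z); rewrite IH ?addnS // !count_cat /= hx ny.
Qed.

(* Only used for words of the same length. *)
Fixpoint lex_lt (lt : rel affgen) (u v : seq affgen) : bool :=
  match u, v with
  | x :: u', y :: v' =>
      if x == y then lex_lt lt u' v' else lt x y
  | _, _ => false
  end.

Definition word_lt (lemn lebi : rel affgen) (u v : seq affgen) : bool :=
  if size (word_mn u) != size (word_mn v) then
    (size (word_mn v) < size (word_mn u))%N
  else if word_mn u != word_mn v then lex_lt lemn (word_mn u) (word_mn v)
  else if size (word_bi u) != size (word_bi v) then
    (size (word_bi u) < size (word_bi v))%N
  else if word_bi u != word_bi v then lex_lt lebi (word_bi u) (word_bi v)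
  else (word_q u < word_q v)%N.

Fixpoint path_word (t : tree AffHS_sig) (j : nat) : seq affgen :=
  match t with
  | Leaf _ _ => [::]
  | Node g ts =>
      (g : affgen) :: flatten
        [seq (if j \in labels s then path_word s j else [::]) | s <- ts]
  end.

Definition path_vector (t : tree AffHS_sig) : seq (seq affgen) :=
  [seq path_word t j | j <- iota 1 (arity t)].

Fixpoint vector_lt (lemn lebi : rel affgen) (a b : seq (seq affgen)) : bool :=
  match a, b with
  | u :: a', v :: b' =>
      word_lt lemn lebi u v
      || (word_nf u == word_nf v) && vector_lt lemn lebi a' b'
  | _, _ => false
  end.

(* The strict part of the partial QM-ordering. *)
Definition QM_lt (lemn lebi : rel affgen) (s t : tree AffHS_sig) : bool :=
  (arity s < arity t)%N
  || (arity s == arity t)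
     && vector_lt lemn lebi (path_vector s) (path_vector t).

Definition extends_QM (lemn lebi : rel affgen) (le : rel (tree AffHS_sig)) :
    Prop :=
  forall s t, tree_monomial s -> tree_monomial t ->
    QM_lt lemn lebi s t -> le s t && (s != t).

(* Main.v *)
(** To a weight w(x, y) = - w(y, x) on the leaf labels, assign to every tree
    monomial the product over its vertices of the sums of w(x, y), with x above
    the first input and y above the second one; the operation i is read as the
    action on one additional point, and m contributes a sign.  By biadditivity
    and antisymmetry of these sums the relations are sent to 0, and the value
    of a composition is the product of the values of the factors for suitable
    weights, so every element of the ideal has value 0 for all weights.

    The leading terms of the relations are beta(beta(1,2),3), m(beta(1,2),3),
    m(beta(1,3),2), n(1,beta(2,3)) and i(beta(1,2)).  Given a monomial t
    divisible by none of them, let w be the signed adjacency matrix of the graph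
    with one edge for each vertex of t, joining representatives of the two sides
    of that vertex.  Then t has value 1 or -1, whereas a monomial s of nonzero
    value has an edge joining the two sides of each of its vertices, and this
    forces s = t or s > t in the QM-ordering.  Hence t is not the leading term
    of an element of the ideal. *)

Require Import Defs.
From mathcomp Require Import all_boot all_order all_algebra.
From mathcomp Require Import finmap monalg.
From mathcomp Require Import zify ring.

Set Implicit Arguments.
Unset Strict Implicit.
Unset Printing Implicit Defensive.

Import GRing.Theory.
Local Open Scope ring_scope.

(** * Trees with output g *)

(** Expanding the value chooses one edge across each vertex, so its coefficients are, up to sign,
    the pairing of trees with directed graphs known from the dual of the Lie operad. Such
    functionals replace the resolution of overlaps between leading terms. For them to respect
    composition, the points of a grafted factor may depend only on its colours, not on the monomial;
    this holds because the additional point occurs exactly once when the output has colour h and no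
    input has, and never otherwise. The representatives are chosen differently for the two colours.
    With output g they are the smallest labels, and the graph of t is a rooted tree with increasing
    edges; path words are powers of beta, and degrees bound depths from below. With output h an
    irreducible monomial lets single labels act one after another, and each is joined to the next
    one, so the graph is a directed path ending in the input of colour h or in the additional point.
    More letters m, n make a word smaller, so there the point is that no competing monomial has more
    of them on the way to any label. *)

Inductive gtree := Gleaf of nat | Gbr of gtree & gtree.

Section LieTrees.
Local Open Scope nat_scope.

Fixpoint glab (a : gtree) : seq nat :=
  match a with Gleaf j => [:: j] | Gbr a b => glab a ++ glab b end.

Fixpoint grep (a : gtree) : nat :=
  match a with Gleaf j => j | Gbr a _ => grep a end.

Fixpoint gincr (a : gtree) : bool :=
  if a is Gbr a b then [&& gincr a, gincr b & grep a < grep b] else true.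

Fixpoint gdepth (a : gtree) (x : nat) : nat :=
  if a is Gbr a b then (if x \in glab a then gdepth a x else gdepth b x).+1
  else 0.

(** Encodes that beta(beta(1,2),3) divides no subtree: the minima of the three inputs being
    distinct, the only alternative to divisibility at a left comb is [grep b < grep a2]. *)
Fixpoint gnormal (a : gtree) : bool :=
  if a is Gbr a b then
    [&& gnormal a, gnormal b & if a is Gbr _ a2 then grep b < grep a2 else true]
  else true.

(** Joining the minima of the two sides makes the graph a rooted tree on the labels, with the
    smallest label as root. *)
Fixpoint gedge (a : gtree) (x y : nat) : bool :=
  if a is Gbr a b then
    [|| gedge a x y, gedge b x y | (x == grep a) && (y == grep b)]
  else false.

Definition crossing (E : rel nat) (A B : seq nat) : Prop :=
  exists x y, [/\ x \in A, y \in B & E x y || E y x].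

(** This is what a nonzero value at a weight supported on [E] forces; see [val_gcrossed]. *)
Fixpoint gcrossed (E : rel nat) (a : gtree) : Prop :=
  if a is Gbr a b then
    [/\ gcrossed E a, gcrossed E b & crossing E (glab a) (glab b)]
  else True.

Lemma grep_lab a : grep a \in glab a.
Proof. by elim: a => //= [j|a IHa b _]; rewrite ?inE // mem_cat IHa. Qed.

Lemma grep_min a : gincr a -> {in glab a, forall x, grep a <= x}.
Proof.
elim: a => /= [j _ x|a IHa b IHb /and3P[oa ob ab] x]; first by rewrite inE => /eqP->.
rewrite mem_cat => /orP[/(IHa oa)//|/(IHb ob) bx].
by rewrite ltnW // (leq_trans ab).
Qed.

Lemma gedge_lab a x y : gedge a x y -> (x \in glab a) && (y \in glab a).
Proof.
elim: a => //= a IHa b IHb; rewrite !mem_cat.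
case/or3P=> [/IHa/andP[-> ->]//|/IHb/andP[-> ->]|/andP[/eqP-> /eqP->]].
  by rewrite !orbT.
by rewrite !grep_lab orbT.
Qed.

Lemma gedge_lt a x y : gincr a -> gedge a x y -> x < y.
Proof.
elim: a => //= a IHa b IHb /and3P[oa ob ab].
by case/or3P=> [/(IHa oa)|/(IHb ob)|/andP[/eqP-> /eqP->]].
Qed.

Lemma gedge_root a x : gincr a -> gedge a x (grep a) = false.
Proof.
move=> oa; apply/negP => e; have /andP[xa _] := gedge_lab e.
by have := gedge_lt oa e; rewrite ltnNge (grep_min oa xa).
Qed.

Lemma uniq_catP (T : eqType) (s1 s2 : seq T) (x : T) :
  uniq (s1 ++ s2) -> x \in s1 -> x \in s2 -> False.
Proof.
rewrite cat_uniq => /and3P[_ /hasPn h _] x1 x2.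
by have := h _ x2; rewrite /= x1.
Qed.

Lemma gedge_parent a x x' y : uniq (glab a) -> gincr a ->
  gedge a x y -> gedge a x' y -> x = x'.
Proof.
elim: a => //= a IHa b IHb u /and3P[oa ob ab].
have [ua ub] : uniq (glab a) /\ uniq (glab b).
  by move: u; rewrite cat_uniq => /and3P[].
have D := uniq_catP u.
case/or3P=> [e|e|/andP[/eqP-> /eqP ey]]; case/or3P=> [e'|e'|/andP[/eqP ex /eqP ey']].
- exact: IHa e e'.
- by case/andP: (gedge_lab e) (gedge_lab e') => _ /D h /andP[_ /h].
- by case/andP: (gedge_lab e) => _ /D []; rewrite ey' grep_lab.
- by case/andP: (gedge_lab e') (gedge_lab e) => _ /D h /andP[_ /h].
- exact: IHb e e'.
- by move: e; rewrite ey' gedge_root.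
- by case/andP: (gedge_lab e') => _ /D []; rewrite ey grep_lab.
- by move: e'; rewrite ey gedge_root.
- by [].
Qed.

(* Edges point from parent to child. *)
Definition parental (E : rel nat) : Prop :=
  (forall x y, E x y -> x < y) /\ (forall x x' y, E x y -> E x' y -> x = x').

Lemma gedge_parental a : uniq (glab a) -> gincr a -> parental (gedge a).
Proof.
by move=> u o; split=> [x y|x x' y]; [exact: gedge_lt|exact: gedge_parent].
Qed.

(** * Degree against depth in trees crossed by a rooted graph *)

Section Crossed.
Variables (E : rel nat) (PE : parental E).

Definition parent_closed (a : gtree) : Prop :=
  {in glab a, forall x, x != grep a -> exists2 p, p \in glab a & E p x}.

(** A label other than the minimum of its side has its only parent on that side, so a crossing edge
    must enter one of the two minima; [grep a] is excluded because edges increase and it is smaller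
    than all of [b]. *)
Lemma crossing_parent a b x y : uniq (glab a ++ glab b) -> gincr (Gbr a b) ->
  parent_closed a -> parent_closed b ->
  x \in glab a -> y \in glab b -> E x y || E y x -> y = grep b /\ E x y.
Proof.
case: PE => Elt Epar u /= /and3P[oa ob ab] ha hb xa yb.
have D := uniq_catP u.
case/orP=> e.
  have [//|yn] := eqVneq y (grep b).
  have [p pb ep] := hb y yb yn.
  by case: (D x) => //; rewrite (Epar _ _ _ e ep).
have [xr|xn] := eqVneq x (grep a).
  have := Elt _ _ e; rewrite xr ltnNge.
  by rewrite (leq_trans (ltnW ab) (grep_min ob yb)).
have [p pa ep] := ha x xa xn.
by case: (D p) => //; rewrite -(Epar _ _ _ e ep).
Qed.

(** The crossing edge at a vertex supplies the parent of [grep b], the one label of [b] whose parent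
    is not in [b]. *)
Lemma gcrossed_parent a : uniq (glab a) -> gincr a -> gcrossed E a ->
  parent_closed a.
Proof.
elim: a => /= [j _ _ _ x|a IHa b IHb u o [Ca Cb [x [y [xa yb e]]]]].
  by rewrite inE => /eqP->; rewrite eqxx.
have /and3P[oa ob ab] := o.
have [ua ub] : uniq (glab a) /\ uniq (glab b).
  by move: u; rewrite cat_uniq => /and3P[].
have ha := IHa ua oa Ca; have hb := IHb ub ob Cb.
have [yr exy] := crossing_parent u o ha hb xa yb e.
move=> z /=; rewrite mem_cat => /orP[za zn|zb zn].
  by have [p pa ep] := ha z za zn; exists p; rewrite ?mem_cat ?pa.
have [zr|zr] := eqVneq z (grep b).
  by exists x; rewrite ?mem_cat ?xa // zr -yr.
by have [p pb ep] := hb z zb zr; exists p; rewrite ?mem_cat ?pb ?orbT.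
Qed.

Lemma crossing_edge a b x y : uniq (glab a ++ glab b) ->
  gincr (Gbr a b) -> gcrossed E (Gbr a b) ->
  x \in glab a -> y \in glab b -> E x y || E y x -> y = grep b /\ E x y.
Proof.
move=> u o [Ca Cb _]; have /= /and3P[oa ob _] := o.
have [ua ub] : uniq (glab a) /\ uniq (glab b).
  by move: u; rewrite cat_uniq => /and3P[].
by apply: crossing_parent => //; exact: gcrossed_parent.
Qed.

Definition degree (S : seq nat) (x : nat) := count (fun y => E x y || E y x) S.

Lemma count_le1 (S : seq nat) (P : pred nat) (z : nat) :
  uniq S -> {in S, forall y, P y -> y = z} -> count P S <= 1.
Proof.
move=> u h; apply: (@leq_trans (count (pred1 z) S)).
  rewrite -!size_filter; apply: uniq_leq_size; first exact: filter_uniq.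
  by move=> y; rewrite !mem_filter => /andP[Py yS]; rewrite /= yS (h _ yS Py) eqxx.
by rewrite count_uniq_mem // leq_b1.
Qed.

(** Each edge at [x] crosses some vertex on the path from [x] to the root, and a vertex is crossed
    by one edge only: its head is [grep b] and its tail the unique parent. *)
Lemma degree_depth a x : uniq (glab a) -> gincr a -> gcrossed E a ->
  x \in glab a -> degree (glab a) x <= gdepth a x.
Proof.
elim: a x => /= [j|a IHa b IHb] x u.
  case: PE => Elt _ _ _; rewrite inE => /eqP->; rewrite /degree /= addn0 orbb.
  by case e: (E j j) => //; have := Elt _ _ e; rewrite ltnn.
move=> o C; have /= /and3P[oa ob ab] := o; have [Ca Cb _] := C.
have [ua ub] : uniq (glab a) /\ uniq (glab b).
  by move: u; rewrite cat_uniq => /and3P[].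
rewrite mem_cat /degree count_cat; case: ifP => [xa _|xa /= xb].
  rewrite -addn1; apply: leq_add; first exact: IHa.
  apply: (@count_le1 _ _ (grep b)) => // y yb e.
  by case: (crossing_edge u o C xa yb e).
rewrite -add1n; apply: leq_add; last exact: IHb.
case: PE => _ Epar.
have [/hasP[z za ez]|/hasPn h] := boolP (has (fun y => E x y || E y x) (glab a)).
  apply: (@count_le1 _ _ z) => // y ya e.
  rewrite orbC in e; rewrite orbC in ez.
  have [_ e1] := crossing_edge u o C ya xb e.
  have [_ e2] := crossing_edge u o C za xb ez.
  exact: Epar e1 e2.
rewrite (eq_in_count (a2 := pred0)) ?count_pred0 // => y ya.
exact/negbTE/h.
Qed.

End Crossed.

Lemma gcrossed_mono (E E' : rel nat) s :
  {in glab s &, forall x y, E x y -> E' x y} -> gcrossed E s -> gcrossed E' s.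
Proof.
elim: s => //= a IHa b IHb h [Ca Cb [x [y [xa yb e]]]]; split.
- by apply: IHa => // u v ua va; apply: h; rewrite mem_cat ?ua ?va.
- by apply: IHb => // u v ua va; apply: h; rewrite mem_cat ?ua ?va orbT.
- exists x, y; split=> //; case/orP: e => /h->; by rewrite ?orbT // mem_cat ?xa ?yb ?orbT.
Qed.

(** The smallest label is the left representative at every vertex on its path to the root, and each
    of these contributes an edge at it. *)
Lemma normal_degree1 t : gnormal t -> uniq (glab t) -> gincr t ->
  gdepth t (grep t) <= degree (gedge t) (glab t) (grep t).
Proof.
elim: t => //= a IHa b _ /and3P[na _ _] u /and3P[oa _ _].
have ua : uniq (glab a) by move: u; rewrite cat_uniq => /and3P[].
rewrite grep_lab /degree count_cat -addn1; apply: leq_add.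
  apply: leq_trans (IHa na ua oa) _; apply: sub_count => y /=.
  by case/orP=> ->; rewrite ?orbT.
by rewrite -has_count; apply/hasP; exists (grep b); rewrite ?grep_lab ?eqxx ?orbT.
Qed.

(** The root contributes the edge from [grep a], the left spine of [b] all the others. *)
Lemma normal_degree2 a b : gnormal (Gbr a b) -> uniq (glab a ++ glab b) ->
  gincr (Gbr a b) ->
  gdepth (Gbr a b) (grep b)
    <= degree (gedge (Gbr a b)) (glab (Gbr a b)) (grep b).
Proof.
move=> /= /and3P[_ nb _] u /and3P[_ ob _].
have ub : uniq (glab b) by move: u; rewrite cat_uniq => /and3P[].
have D := uniq_catP u.
case: ifP => [/D/(_ (grep_lab b))//|_].
rewrite /degree count_cat -add1n; apply: leq_add.
  by rewrite -has_count; apply/hasP; exists (grep a); rewrite ?grep_lab ?eqxx ?orbT.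
apply: leq_trans (normal_degree1 nb ub ob) _; apply: sub_count => y /=.
by case/orP=> ->; rewrite ?orbT.
Qed.

(** Normality makes the right representatives increase down the left spine, so the topmost one is
    the smallest of them. *)
Lemma normal_second a b x : gnormal (Gbr a b) -> gincr (Gbr a b) ->
  x \in glab (Gbr a b) -> x != grep a -> grep b <= x.
Proof.
elim: a b x => [j|a1 IH a2 _] b x.
  move=> _ /= /andP[ob _]; rewrite inE => /orP[->//|xb _].
  exact: grep_min.
move=> /= /and3P[n nb lt] /and3P[o ob ab].
rewrite mem_cat => /orP[xa xn|xb _]; last exact: grep_min.
exact/ltnW/(leq_trans lt)/IH.
Qed.

(** A lexicographic comparison located at its deciding label. Only membership in [S] matters, so
    comparisons of two subtrees with interleaved labels can be merged. *)
Definition first_lt (S : seq nat) (tie lt : nat -> Prop) : Prop :=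
  exists x, [/\ x \in S, {in S, forall y, y < x -> tie y} & lt x].

Lemma first_lt_mono (S : seq nat) (tie lt tie' lt' : nat -> Prop) :
  {in S, forall x, tie x -> tie' x} -> {in S, forall x, lt x -> lt' x} ->
  first_lt S tie lt -> first_lt S tie' lt'.
Proof.
move=> ht hl [x [xS tx lx]]; exists x; split=> // [y yS yx|]; last exact: hl.
exact/ht/tx.
Qed.

(** When both lists are decided, the smaller of the two deciding labels decides the union. *)
Lemma first_lt_catl (A B : seq nat) (tie lt : nat -> Prop) :
  first_lt A tie lt -> {in B, forall y, tie y} \/ first_lt B tie lt ->
  first_lt (A ++ B) tie lt.
Proof.
move=> [x [xA tx lx]] [tB|[z [zB tz lz]]].
  exists x; split=> // [|y]; first by rewrite mem_cat xA.
  by rewrite mem_cat => /orP[/tx|/tB].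
have [xz|zx] := leqP x z.
  exists x; split=> // [|y]; first by rewrite mem_cat xA.
  rewrite mem_cat => /orP[/tx//|yB yx]; apply: tz => //; exact: leq_trans xz.
exists z; split=> // [|y]; first by rewrite mem_cat zB orbT.
rewrite mem_cat => /orP[yA yz|/tz//]; apply: tx => //; exact: ltn_trans zx.
Qed.

Lemma first_lt_perm (A B : seq nat) (tie lt : nat -> Prop) :
  A =i B -> first_lt A tie lt -> first_lt B tie lt.
Proof.
move=> AB [x [xA tx lx]]; exists x; split=> // [|y]; first by rewrite -AB.
by rewrite -AB; exact: tx.
Qed.

Lemma first_lt_catr (A B : seq nat) (tie lt : nat -> Prop) :
  first_lt B tie lt -> {in A, forall y, tie y} \/ first_lt A tie lt ->
  first_lt (A ++ B) tie lt.
Proof.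
move=> hB hA; apply: first_lt_perm (first_lt_catl hB hA) => x.
by rewrite !mem_cat orbC.
Qed.

Definition gless (t s : gtree) : Prop :=
  first_lt (glab t) (fun y => gdepth t y = gdepth s y)
    (fun y => gdepth t y < gdepth s y).

(* In both trees the depth of a label is at least its degree in the graph of t,
   and in t equality holds for the two smallest labels.  If the second smallest
   label lies in the left subtree of s, no edge at the root of s meets both
   labels, so one of them is strictly deeper in s than in t. *)
Theorem gnormal_min t s :
  uniq (glab t) -> gincr t -> gincr s -> gnormal t ->
  perm_eq (glab t) (glab s) -> gcrossed (gedge t) s -> t = s \/ gless t s.
Proof.
elim: t s => [j|a IHa b IHb] s ut ot os nt ts C.
  left; case: s ts {os C} => [i /perm_mem /(_ j)|c d /perm_size] /=.
    by rewrite !inE eqxx => /esym/eqP->.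
  have := grep_lab c; have := grep_lab d; rewrite size_cat.
  by case: (glab c) => //; case: (glab d) => //= ? ? ? ?; rewrite addnS.
have us : uniq (glab s) by rewrite -(perm_uniq ts).
case: s ts us os C => [i /perm_size /=|c d].
  have := grep_lab a; have := grep_lab b; rewrite size_cat.
  by case: (glab a) => //; case: (glab b) => //= ? ? ? ?; rewrite addnS.
move=> ts us os C; have /= /and3P[oc od cd] := os; have [Cc Cd _] : [/\ gcrossed (gedge (Gbr a b)) c, gcrossed (gedge (Gbr a b)) d
  & crossing (gedge (Gbr a b)) (glab c) (glab d)] := C.
have ut' : uniq (glab a ++ glab b) := ut.
rewrite ![glab (Gbr _ _)]/= in ts us.
have Ets := perm_mem ts.
have PE := gedge_parental ut ot.
have [uc ud] : uniq (glab c) /\ uniq (glab d).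
  by move: us; rewrite cat_uniq => /and3P[].
have [ua ub] : uniq (glab a) /\ uniq (glab b).
  by move: (ut); rewrite /= cat_uniq => /and3P[].
have Ds := uniq_catP us; have Dt := uniq_catP ut'.
have /= /and3P[oa ob ab] := ot.
have /= /and3P[na nb _] := nt.
have ac : grep a = grep c.
  apply/eqP; rewrite eqn_leq; apply/andP; split.
    by apply: (@grep_min (Gbr a b)) => //=; rewrite Ets mem_cat grep_lab.
  by apply: (@grep_min (Gbr c d)) => //=; rewrite -Ets mem_cat grep_lab.
have : grep b \in glab c ++ glab d by rewrite -Ets mem_cat grep_lab orbT.
rewrite mem_cat => /orP[b2c|b2d].
  right.
  have d1 := degree_depth PE (us : uniq (glab (Gbr c d))) os C (x := grep a).
  have d2 := degree_depth PE (us : uniq (glab (Gbr c d))) os C (x := grep b).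
  have n1 := normal_degree1 nt ut ot; have n2 := normal_degree2 nt ut ot.
  have a1c : grep a \in glab c by rewrite ac grep_lab.
  have second x : x \in glab a ++ glab b -> x != grep a -> grep b <= x.
    exact: (@normal_second a b).
  have degE S x : degree (gedge (Gbr a b)) S x
      = count (fun y => gedge (Gbr a b) x y || gedge (Gbr a b) y x) S by [].
  have e1 := degree_depth PE uc oc Cc a1c.
  have e2 := degree_depth PE uc oc Cc b2c.
  have T1 : degree (gedge (Gbr a b)) (glab a ++ glab b) =1
            degree (gedge (Gbr a b)) (glab c ++ glab d).
    by move=> x; rewrite !degE; apply/permP.
  have [/hasP[y yd ey]|/hasPn h] :=
    boolP (has (fun y => gedge (Gbr a b) (grep a) y || gedge (Gbr a b) y (grep a)) (glab d)).
    (* Edges from both labels into [d] would both enter [grep d], which has only one parent. *)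
    have k2 : count (fun y => gedge (Gbr a b) (grep b) y || gedge (Gbr a b) y (grep b)) (glab d) = 0.
      apply/eqP; rewrite -leqn0 leqNgt -has_count; apply/hasPn => z zd; apply/negP => ez.
      have [yE ea] := crossing_edge PE us os C a1c yd ey.
      have [zE eb] := crossing_edge PE us os C b2c zd ez.
      have := PE.2 (grep a) (grep b) (grep d); rewrite -{1}yE -zE ea eb => /(_ isT isT) eab.
      by move: ab; rewrite eab ltnn.
    (* All edges at [grep b] stay inside [c], whose depths already dominate the degree; the root of
       [s] adds one more. *)
    have lt2 : gdepth (Gbr a b) (grep b) < gdepth (Gbr c d) (grep b).
      move: n2; rewrite [glab _]/= T1 degE count_cat k2 addn0 => n2.
      by rewrite /= b2c ltnS; exact: leq_trans n2 e2.
    have le1 : gdepth (Gbr a b) (grep a) <= gdepth (Gbr c d) (grep a).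
      apply: leq_trans n1 _; rewrite [glab _]/= T1; apply: d1.
      by rewrite mem_cat a1c.
    move: le1; rewrite leq_eqVlt => /orP[/eqP eq1|lt1].
      exists (grep b); split=> //=; first by rewrite mem_cat grep_lab orbT.
      move=> z zt zb; have [->//|/(second _ zt)] := eqVneq z (grep a).
      by rewrite leqNgt zb.
    exists (grep a); split=> //=; first by rewrite mem_cat grep_lab.
    by move=> z zt; rewrite ltnNge (grep_min ot).
  exists (grep a); split; first by rewrite mem_cat grep_lab.
    by move=> y yt; rewrite ltnNge (grep_min ot).
  have k1 : count (fun y => gedge (Gbr a b) (grep a) y || gedge (Gbr a b) y (grep a)) (glab d) = 0.
    by apply/eqP; rewrite -leqn0 leqNgt -has_count; apply/hasPn.
  move: n1; rewrite [grep _]/= [glab _]/= T1 degE count_cat k1 addn0 => n1.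
  by rewrite [gdepth (Gbr c d) _]/= a1c ltnS; exact: leq_trans n1 e1.
have bd : grep b = grep d.
  apply/eqP; rewrite eqn_leq; apply/andP; split; last exact: grep_min.
  apply: (normal_second nt ot).
    by rewrite /= Ets mem_cat grep_lab orbT.
  by rewrite ac neq_ltn cd orbT.
(* Induction on the size of the label: its parent lies in [d], hence in [b], and the only edge
   between the two halves of [t] starts in [a], so the label itself is in [b]. *)
have db : {subset glab d <= glab b}.
  move=> x; have [n] := ubnP x; elim: n x => // n IH x /ltnSE xn xd.
  have [->|xr] := eqVneq x (grep d); first by rewrite -bd grep_lab.
  have [p pd ep] := gcrossed_parent PE ud od Cd xd xr.
  have pb := IH p (leq_trans (PE.1 _ _ ep) xn) pd.
  case/or3P: ep => [/gedge_lab/andP[/Dt/(_ pb)]//|/gedge_lab/andP[]//|/andP[/eqP pa _]].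
  by case: (Dt p); rewrite ?pb // pa grep_lab.
(* Same induction; the only edge leaving [a] enters [grep b], which lies in [d]. *)
have ca : {subset glab c <= glab a}.
  move=> x; have [n] := ubnP x; elim: n x => // n IH x /ltnSE xn xc.
  have [->|xr] := eqVneq x (grep c); first by rewrite -ac grep_lab.
  have [p pc ep] := gcrossed_parent PE uc oc Cc xc xr.
  have pa := IH p (leq_trans (PE.1 _ _ ep) xn) pc.
  case/or3P: ep => [/gedge_lab/andP[]//|/gedge_lab/andP[/(Dt _ pa)]//|/andP[_ /eqP xb]].
  by case: (Ds x) => //; rewrite xb.
have pac : perm_eq (glab a) (glab c).
  apply: uniq_perm => // x; apply/idP/idP; last exact: ca.
  move=> xa; have : x \in glab c ++ glab d by rewrite -Ets mem_cat xa.
  by rewrite mem_cat => /orP[//|/db/(Dt _ xa)].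
have pbd : perm_eq (glab b) (glab d).
  apply: uniq_perm => // x; apply/idP/idP; last exact: db.
  move=> xb; have : x \in glab c ++ glab d by rewrite -Ets mem_cat xb orbT.
  by rewrite mem_cat => /orP[/ca/Dt/(_ xb)|].
have Cac : gcrossed (gedge a) c.
  apply: gcrossed_mono Cc => x y /ca xa /ca ya /or3P[//|/gedge_lab/andP[/(Dt _ xa)]//|/andP[_ /eqP yb]].
  by case: (Dt y) => //; rewrite yb grep_lab.
have Cbd : gcrossed (gedge b) d.
  apply: gcrossed_mono Cd => x y /db xb /db yb /or3P[/gedge_lab/andP[/Dt/(_ xb)]//|//|/andP[/eqP xa _]].
  by case: (Dt x) => //; rewrite xa grep_lab.
have {}IHa := IHa c ua oa oc na pac Cac.
have {}IHb := IHb d ub ob od nb pbd Cbd.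
have dep x : gdepth (Gbr a b) x = (if x \in glab a then gdepth a x else gdepth b x).+1 by [].
have dep' x : gdepth (Gbr c d) x = (if x \in glab a then gdepth c x else gdepth d x).+1.
  by rewrite /= (perm_mem pac).
have inb x : x \in glab b -> x \in glab a = false.
  by move=> xb; apply/negP => /Dt/(_ xb).
have fa : a = c \/ first_lt (glab a) (fun y => gdepth (Gbr a b) y = gdepth (Gbr c d) y)
    (fun y => gdepth (Gbr a b) y < gdepth (Gbr c d) y).
  case: IHa => [|h]; [by left|right].
  by apply: first_lt_mono h => x xa; rewrite dep dep' xa => // ->.
have fb : b = d \/ first_lt (glab b) (fun y => gdepth (Gbr a b) y = gdepth (Gbr c d) y)
    (fun y => gdepth (Gbr a b) y < gdepth (Gbr c d) y).
  case: IHb => [|h]; [by left|right].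
  by apply: first_lt_mono h => x xb; rewrite dep dep' (inb _ xb) => // ->.
case: fa => [ea|fa]; last first.
  right; apply: first_lt_catl => //; case: fb => [eb|]; [left|by right].
  by move=> x xb; rewrite dep dep' (inb _ xb) eb.
case: fb => [eb|fb]; first by left; rewrite ea eb.
right; apply: first_lt_catr => //; left.
by move=> x xa; rewrite dep dep' xa ea.
Qed.
End LieTrees.

(** * Trees with output h *)

Inductive htree := Hleaf of nat | Hinj of gtree | Hact of gtree & htree.

Section ModuleTrees.
Local Open Scope nat_scope.

Fixpoint hlab (h : htree) : seq nat :=
  match h with
  | Hleaf p => [:: p] | Hinj a => glab a | Hact a h => glab a ++ hlab h
  end.

(* The operation i is read as the action on an additional point, labelled 0. *)
Fixpoint hpts (h : htree) : seq nat :=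
  match h with
  | Hleaf p => [:: p] | Hinj a => 0 :: glab a | Hact a h => glab a ++ hpts h
  end.

(** The point being acted on: the input of colour h, or the additional point if there is none. *)
Fixpoint hend (h : htree) : nat :=
  match h with Hleaf p => p | Hinj _ => 0 | Hact _ h => hend h end.

Fixpoint hmin (h : htree) : nat :=
  match h with
  | Hleaf p => p | Hinj a => grep a | Hact a h => minn (grep a) (hmin h)
  end.

(** Not the minimum but the label met first, so that for a normal tree [hedge] joins consecutive
    labels and forms a directed path ending at [hend]. *)
Definition hrep (h : htree) : nat :=
  match h with Hleaf p => p | Hinj a => grep a | Hact a h => grep a end.

Fixpoint hincr (h : htree) : bool :=
  match h with
  | Hleaf p => true | Hinj a => gincr a | Hact a h => gincr a && hincr h
  end.

Definition is_gleaf (a : gtree) : bool := if a is Gleaf _ then true else false.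

(** The leading terms with output h cover every bracket inserted directly into i, m or n, whatever
    the order of the labels; hence only single labels may act. *)
Fixpoint hnormal (h : htree) : bool :=
  match h with
  | Hleaf _ => true | Hinj a => is_gleaf a
  | Hact a h => is_gleaf a && hnormal h
  end.

Fixpoint hedge (h : htree) (x y : nat) : bool :=
  match h with
  | Hleaf _ => false
  | Hinj a => (x == grep a) && (y == 0)
  | Hact a h => hedge h x y || (x == grep a) && (y == hrep h)
  end.

Fixpoint hcrossed (E : rel nat) (h : htree) : Prop :=
  match h with
  | Hleaf _ => True
  | Hinj a => gcrossed E a /\ crossing E (glab a) [:: 0]
  | Hact a h =>
      [/\ gcrossed E a, hcrossed E h & crossing E (glab a) (hpts h)]
  end.

Definition act_letter (a : gtree) (h : htree) : affgen :=
  if grep a < hmin h then Gm else Gn.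

Definition gpath (a : gtree) (x : nat) : seq affgen := nseq (gdepth a x) Gbeta.

Fixpoint hpath (h : htree) (x : nat) : seq affgen :=
  match h with
  | Hleaf _ => [::]
  | Hinj a => Gi :: gpath a x
  | Hact a h => act_letter a h :: if x \in glab a then gpath a x else hpath h x
  end.

(** Number of letters m, n in the path word, the first criterion in comparing words. *)
Fixpoint height (h : htree) (x : nat) : nat :=
  if h is Hact a h then if x \in glab a then 1 else (height h x).+1 else 0.

Lemma hend_pts h : hend h \in hpts h.
Proof. by elim: h => /= [p|a|a h IH]; rewrite ?inE // mem_cat IH orbT. Qed.

Lemma hlab_pts h : {subset hlab h <= hpts h}.
Proof.
elim: h => /= [p //|a x|a h IH x]; first by rewrite inE => ->; rewrite orbT.
by rewrite !mem_cat => /orP[->//|/IH->]; rewrite orbT.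
Qed.

Lemma hrep_lab h : hrep h \in hlab h.
Proof. by case: h => [p|a|a h] /=; rewrite ?inE ?mem_cat ?grep_lab. Qed.

Lemma hmin_lab h : hmin h \in hlab h.
Proof.
elim: h => /= [p|a|a h IH]; rewrite ?inE ?grep_lab // mem_cat.
by rewrite minnE; case: (leqP (grep a) (hmin h)) => h1; rewrite -?minnE ?(minn_idPl h1) ?(minn_idPr (ltnW h1)) ?grep_lab ?IH ?orbT.
Qed.

Lemma hmin_min h : hincr h -> {in hlab h, forall x, hmin h <= x}.
Proof.
elim: h => /= [p _ x|a oa x|a h IH /andP[oa oh] x].
- by rewrite inE => /eqP->.
- exact: grep_min.
- by rewrite mem_cat geq_min => /orP[/(grep_min oa)->//|/(IH oh)->]; rewrite orbT.
Qed.

Lemma hmin_eq s t : hincr s -> hincr t -> hlab s =i hlab t -> hmin s = hmin t.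
Proof.
move=> os ot st; apply/eqP; rewrite eqn_leq; apply/andP; split; apply: hmin_min => //.
  by rewrite st hmin_lab.
by rewrite -st hmin_lab.
Qed.

Lemma hedge_pts t x y : hedge t x y -> (x \in hpts t) && (y \in hpts t).
Proof.
elim: t => //= [a /andP[/eqP-> /eqP->]|a h IH].
  by rewrite !inE eqxx grep_lab orbT.
rewrite !mem_cat => /orP[/IH/andP[-> ->]|/andP[/eqP-> /eqP->]].
  by rewrite !orbT.
by rewrite grep_lab (hlab_pts (hrep_lab h)) orbT.
Qed.

Lemma hedge_end t y : uniq (hpts t) -> hedge t (hend t) y = false.
Proof.
elim: t => //= [a|a h IH].
  by case/andP=> h _; apply/negP => /andP[/eqP e]; rewrite e grep_lab in h.
move=> u; rewrite IH /=; last by move: u; rewrite cat_uniq => /and3P[].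
apply/negP => /andP[/eqP e _]; apply: (uniq_catP u (grep_lab a)).
by rewrite -e hend_pts.
Qed.

Lemma hedge_next t x y y' : uniq (hpts t) ->
  hedge t x y -> hedge t x y' -> y = y'.
Proof.
elim: t => //= [a _ /andP[_ /eqP->] /andP[_ /eqP->] //|a h IH u].
have uh : uniq (hpts h) by move: u; rewrite cat_uniq => /and3P[].
have D z : hedge h (grep a) z -> False.
  by move=> /hedge_pts/andP[+ _]; apply: (uniq_catP u (grep_lab a)).
case/orP=> [e|/andP[/eqP ex /eqP->]]; case/orP=> [e'|/andP[/eqP ex' /eqP-> //]].
- exact: IH e e'.
- by case: (D y); rewrite -ex'.
- by case: (D y'); rewrite -ex.
Qed.

(** The path starts at [hrep t], and following successors from there exhausts it. Consequently a
    proper part closed under successors misses the first label. *)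
Lemma hedge_up t (S : pred nat) : hnormal t -> uniq (hpts t) ->
  {in S, forall x, x != hend t -> exists2 y, y \in S & hedge t x y} ->
  hrep t \in S -> {subset hpts t <= S}.
Proof.
elim: t S => /= [p S _ _ _ pS x|[a|//] S _|[a|//] h IH S nh].
- by rewrite inE => /eqP->.
- rewrite /= inE andbT => a0 hS aS x.
  have [y yS] : exists2 y, y \in S & (a == a) && (y == 0).
    by apply: (hS a) => //; rewrite eq_sym.
  rewrite eqxx => /eqP y0; rewrite !inE => /orP[/eqP->|/eqP->//].
  by rewrite -y0.
- move=> u hS aS.
  have /andP[an uh] : (a \notin hpts h) && uniq (hpts h) := u.
  have rS : hrep h \in S.
    have [|y yS] := hS a aS; first by apply: contraNneq an => ->; rewrite hend_pts.
    case/orP=> [/hedge_pts/andP[ah]|/andP[_ /eqP<-//]].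
    by rewrite ah in an.
  have /(_ nh uh) H := IH [pred x in S | x \in hpts h].
  have {H} sub : {subset hpts h <= [pred x in S | x \in hpts h]}.
    apply: H => [x /andP[xS xh] xe|]; last by rewrite inE rS (hlab_pts (hrep_lab h)).
    have [y yS] := hS x xS xe; case/orP=> [e|/andP[/eqP xa _]].
      by exists y => //; rewrite inE yS; case/andP: (hedge_pts e).
    by move: an; rewrite -[a]/(grep (Gleaf a)) -xa xh.
  by move=> x; rewrite inE => /orP[/eqP->//|/sub/andP[]].
Qed.

(** * Trees crossed by a graph with at most one edge out of each point *)

Section Crossed.
Variables (E : rel nat).
Hypothesis Enext : forall x y y', E x y -> E x y' -> y = y'.

(** The crossing edge has to start at the sink of its side, since the other labels have spent their
    only outgoing edge there; the sink of the opposite side survives. *)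
Lemma gcrossed_sink a : uniq (glab a) -> gcrossed E a ->
  exists2 r, r \in glab a &
    {in glab a, forall x, x != r -> exists2 y, y \in glab a & E x y}.
Proof.
elim: a => /= [j _ _|a IHa b IHb u [Ca Cb [x [y [xa yb e]]]]].
  by exists j; rewrite ?inE // => x; rewrite inE => /eqP->; rewrite eqxx.
have [ua ub] : uniq (glab a) /\ uniq (glab b).
  by move: u; rewrite cat_uniq => /and3P[].
have [ra raa ha] := IHa ua Ca; have [rb rbb hb] := IHb ub Cb.
have D := uniq_catP u.
case/orP: e => e.
  have xr : x = ra.
    apply/eqP/negPn/negP => /(ha _ xa)[z za /(Enext e) yz].
    by apply: (D z) => //; rewrite -yz.
  exists rb; first by rewrite mem_cat rbb orbT.
  move=> z; rewrite mem_cat => /orP[za _|/hb zb /zb [w wb ew]].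
    have [->|/(ha _ za) [w wa ew]] := eqVneq z ra.
      by exists y; rewrite -?xr // mem_cat yb orbT.
    by exists w; rewrite ?mem_cat ?wa.
  by exists w; rewrite ?mem_cat ?wb ?orbT.
have yr : y = rb.
  apply/eqP/negPn/negP => /(hb _ yb)[z zb /(Enext e) xz].
  by apply: (D z) => //; rewrite -xz.
exists ra; first by rewrite mem_cat raa.
move=> z; rewrite mem_cat => /orP[/ha za /za [w wa ew]|zb _].
  by exists w; rewrite ?mem_cat ?wa.
have [->|/(hb _ zb) [w wb ew]] := eqVneq z rb.
  by exists x; rewrite -?yr // mem_cat xa.
by exists w; rewrite ?mem_cat ?wb ?orbT.
Qed.

(** At an action vertex the crossing edge cannot come out of [h], where outgoing edges are spent or,
    at the end, missing. When the graph is a path, the points of [s] and of each of its lower parts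
    therefore form final segments. *)
Lemma hcrossed_next s : uniq (hpts s) -> hcrossed E s ->
  (forall y, E (hend s) y = false) ->
  {in hpts s, forall x, x != hend s -> exists2 y, y \in hpts s & E x y}.
Proof.
elim: s => /= [p _ _|a /andP[a0 ua] [Ca [x [y [xa y0 e]]]]|a h IH u [Ca Ch [x [y [xa yh e]]]]] end0.
- by move=> x; rewrite inE => ->.
- have {y0 e} e : E x 0 by move: y0 e; rewrite inE => /eqP->; rewrite end0 orbF.
  have [r ra h] := gcrossed_sink ua Ca.
  have xr : x = r.
    apply/eqP/negPn/negP => /(h _ xa)[z za /(Enext e) yz].
    by rewrite yz za in a0.
  move=> z; rewrite inE => /orP[->//|za _].
  have [->|/(h _ za) [w wa ew]] := eqVneq z r.
    by exists 0; rewrite ?inE // -xr.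
  by exists w; rewrite ?inE ?wa ?orbT.
- have [ua uh] : uniq (glab a) /\ uniq (hpts h).
    by move: u; rewrite cat_uniq => /and3P[].
  have D := uniq_catP u.
  have [r ra ha] := gcrossed_sink ua Ca; have hh := IH uh Ch end0.
  have {}e : E x y.
    case/orP: e => // e.
    have [ye|/(hh _ yh) [z zh /(Enext e) xz]] := eqVneq y (hend h).
      by rewrite ye end0 in e.
    by case: (D x); rewrite // xz.
  have xr : x = r.
    apply/eqP/negPn/negP => /(ha _ xa)[z za /(Enext e) yz].
    by apply: (D z) => //; rewrite -yz.
  move=> z; rewrite mem_cat => /orP[za _|/hh zh /zh [w wh ew]].
    have [->|/(ha _ za) [w wa ew]] := eqVneq z r.
      by exists y; rewrite -?xr // mem_cat yh orbT.
    by exists w; rewrite ?mem_cat ?wa.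
  by exists w; rewrite ?mem_cat ?wh ?orbT.
Qed.

End Crossed.

Lemma hcrossed_mono (E E' : rel nat) s :
  {in hpts s &, forall x y, E x y -> E' x y} -> hcrossed E s -> hcrossed E' s.
Proof.
elim: s => //= [a H [Ca [x [y [xa y0 e]]]]|a h IH H [Ca Ch [x [y [xa yh e]]]]].
  split; first by apply: gcrossed_mono Ca => u v ua va; apply: H; rewrite inE ?ua ?va orbT.
  have xh : x \in 0 :: glab a by rewrite inE xa orbT.
  have yh : y \in 0 :: glab a by move: y0; rewrite !inE => ->.
  by exists x, y; split=> //; case/orP: e => /H->; rewrite ?orbT.
have xh : x \in glab a ++ hpts h by rewrite mem_cat xa.
have yah : y \in glab a ++ hpts h by rewrite mem_cat yh orbT.
split; first by apply: gcrossed_mono Ca => u v ua va; apply: H; rewrite mem_cat ?ua ?va.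
  by apply: IH => // u v ua va; apply: H; rewrite mem_cat ?ua ?va orbT.
by exists x, y; split=> //; case/orP: e => /H->; rewrite ?orbT.
Qed.

(** The one edge lost in passing to the shorter path starts at [a], which is not a point of [s]. *)
Lemma hedge_act_mono a t s : uniq (hpts (Hact (Gleaf a) t)) ->
  {subset hpts s <= hpts t} ->
  hcrossed (hedge (Hact (Gleaf a) t)) s -> hcrossed (hedge t) s.
Proof.
move=> /= /andP[an _] sub; apply: hcrossed_mono => x y /sub xt _.
by case/orP=> // /andP[/eqP xa _]; rewrite -xa xt in an.
Qed.

(** The tree [s] cuts a final segment of the path of [t] into consecutive blocks; its heights count
    blocks, whereas those of [t] count single labels. *)
Lemma height_le t s : hnormal t -> uniq (hpts t) -> uniq (hpts s) ->
  0 \notin hlab s -> hend s = hend t ->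
  {subset hpts s <= hpts t} -> hcrossed (hedge t) s ->
  {in hlab s, forall x, height s x <= height t x}.
Proof.
elim: t s => [p|[a|//]|[a|//] t IH] s nt ut us s0 est sub C x xs.
- case: s us {s0} est sub {C} x xs => //= a h u <- sub x _.
  have := sub (grep a); rewrite mem_cat grep_lab => /(_ isT); rewrite inE => /eqP e.
  by case: (uniq_catP u (grep_lab a)); rewrite e hend_pts.
- case: s us s0 est sub {C} x xs => //= b h u s0 e0 sub x _.
  have hb : grep b \in [:: 0; a] by apply: sub; rewrite mem_cat grep_lab.
  have hr : hrep h \in [:: 0; a].
    by apply: sub; rewrite mem_cat (hlab_pts (hrep_lab h)) orbT.
  case: (uniq_catP u (grep_lab b)).
  move: hb hr s0; rewrite !inE mem_cat negb_or.
  case/orP=> /eqP eb; first by rewrite -eb grep_lab.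
  case/orP=> /eqP er; first by rewrite -er hrep_lab andbF.
  by rewrite eb -er (hlab_pts (hrep_lab h)).
- have /= /andP[an uh] := ut.
  have clo := hcrossed_next (fun x y y' => @hedge_next _ x y y' ut) us C.
  have {}clo := clo (fun y => etrans (congr1 (fun z => hedge _ z y) est) (hedge_end y ut)).
  (* If the first label of the path is absent from [s], all of [s] lives on the shorter path. *)
  have [as_|ans] := boolP (a \in hpts s); last first.
    have subt : {subset hpts s <= hpts t}.
      by move=> y ys; have := sub y ys; rewrite inE => /orP[/eqP ya|//]; rewrite -ya ys in ans.
    have le := IH s nt uh us s0 est subt (hedge_act_mono ut subt C) x xs.
    apply: leq_trans le _ => /=; rewrite inE; case: eqP => // xa.
    by rewrite -xa (hlab_pts xs) in ans.
  case: s us s0 est sub C xs clo as_ => // b s us s0 est sub C.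
  rewrite /= mem_cat; case: ifP => [xb _ _ _|xb /= xs clo as_].
    by rewrite inE; case: eqP.
  have [ub us'] : uniq (glab b) /\ uniq (hpts s).
    by move: us; rewrite cat_uniq => /and3P[].
  have s0' : 0 \notin hlab s by move: s0; rewrite mem_cat negb_or => /andP[].
  have Cs : hcrossed (hedge (Hact (Gleaf a) t)) s by case: C.
  have clos := hcrossed_next (fun x y y' => @hedge_next _ x y y' ut) us' Cs.
  have {}clos := clos (fun y => etrans (congr1 (fun z => hedge _ z y) est) (hedge_end y ut)).
  (* Otherwise the part below the block [b] would contain the whole path, including the labels of
     [b]. *)
  have ans : a \notin hpts s.
    apply/negP => as'.
    have full := @hedge_up (Hact (Gleaf a) t) (mem (hpts s)) nt ut.
    have {}full := full (fun y ys ye => clos y ys (eq_ind_r (fun z => y != z) ye est)) as'.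
    have bt : grep b \in hpts (Hact (Gleaf a) t) by apply: sub; rewrite mem_cat grep_lab.
    exact: (uniq_catP us (grep_lab b) (full _ bt)).
  have subt : {subset hpts s <= hpts t}.
    move=> y ys; have := sub y; rewrite mem_cat ys orbT inE => /(_ isT).
    by case/orP=> // /eqP ya; rewrite -ya ys in ans.
  rewrite inE; case: eqP => [xa|_]; first by rewrite -xa (hlab_pts xs) in ans.
  exact: IH s nt uh us' s0' est subt (hedge_act_mono ut subt Cs) x xs.
Qed.

Lemma hpts_lab h x : x \in hpts h -> x != 0 -> x \in hlab h.
Proof.
elim: h => //= [a|a h IH]; first by rewrite inE => /orP[/eqP->|].
by rewrite !mem_cat => /orP[->//|/IH xh /xh->]; rewrite orbT.
Qed.

(** * Words along paths and their comparison *)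

Lemma word_nf_gpath a x :
  word_nf (gpath a x) = ([::], nseq (gdepth a x) Gbeta, 0).
Proof.
rewrite /word_nf /gpath; elim: (gdepth a x) => //= n [mn bi q].
by rewrite q -size_filter -/(word_mn _) mn bi.
Qed.

Lemma word_mn_gpath a x : word_mn (gpath a x) = [::].
Proof. by case: (word_nf_gpath a x). Qed.

Lemma word_bi_gpath a x : word_bi (gpath a x) = nseq (gdepth a x) Gbeta.
Proof. by case: (word_nf_gpath a x). Qed.

Lemma size_word_mn_hpath h x : size (word_mn (hpath h x)) = height h x.
Proof.
elim: h => //= [a|a h IH]; first by rewrite word_mn_gpath.
have -> : in_mn (act_letter a h) by rewrite /act_letter; case: ifP.
by case: ifP => //= _; [rewrite word_mn_gpath|rewrite IH].
Qed.

Lemma word_nf_cons g u v : in_mn g -> word_nf u = word_nf v ->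
  word_nf (g :: u) = word_nf (g :: v).
Proof. by rewrite /word_nf; case: g => // _ [mn bi q] /=; rewrite mn bi q. Qed.

Section WordOrder.
Variables (lemn lebi : rel affgen).

Lemma word_lt_cons g u v : in_mn g ->
  word_lt lemn lebi (g :: u) (g :: v) = word_lt lemn lebi u v.
Proof. by case: g => // _; rewrite /word_lt /= eqSS ltnS eqseq_cons eqxx. Qed.

Lemma word_lt_mn u v : size (word_mn v) < size (word_mn u) ->
  word_lt lemn lebi u v.
Proof. by move=> h; rewrite /word_lt h gtn_eqF. Qed.

Lemma word_lt_bi u v : word_mn u = word_mn v ->
  size (word_bi u) < size (word_bi v) -> word_lt lemn lebi u v.
Proof. by move=> e h; rewrite /word_lt e h !eqxx /= ltn_eqF. Qed.

Definition path_less (S : seq nat) (p q : nat -> seq affgen) : Prop :=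
  first_lt S (fun y => word_nf (p y) = word_nf (q y))
    (fun y => word_lt lemn lebi (p y) (q y)).

Lemma gless_path t s : gless t s -> path_less (glab t) (gpath t) (gpath s).
Proof.
apply: first_lt_mono => x _; first by rewrite !word_nf_gpath => ->.
move=> lt; apply: word_lt_bi; first by rewrite !word_mn_gpath.
by rewrite !word_bi_gpath !size_nseq.
Qed.

(* The graph of t is a path.  If the first block of s is not a single label,
   every label other than the first one on the path has fewer letters m, n on
   its way to the root in s than in t, and the comparison is already decided at
   the smallest label. *)
Theorem hnormal_min t s :
  uniq (hpts t) -> 0 \notin hlab t -> 0 \notin hlab s -> hnormal t -> hincr s ->
  perm_eq (hpts t) (hpts s) -> hend t = hend s -> hcrossed (hedge t) s ->
  t = s \/ path_less (hlab t) (hpath t) (hpath s).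
Proof.
elim: t s => [p|[a|//]|[a|//] t IH] s ut t0 s0 nt os ts est C.
- left; case: s ts est {s0 os C} => [q /= _ ->//|b /perm_size|b h /perm_size] /=.
    by have := grep_lab b; case: (glab b).
  rewrite size_cat; have := grep_lab b; have := hend_pts h.
  by case: (glab b) => // ? ?; case: (hpts h) => //= ? ? _ _; rewrite addnS.
- left; case: s ts est s0 {os C} => [q /perm_size//|b ts _ _|b h ts est] /=.
    move: ts; rewrite /= perm_cons => ts; congr Hinj.
    case: b ts => [i /perm_mem /(_ a)|c d /perm_size] /=.
      by rewrite !inE eqxx => /esym/eqP->.
    have := grep_lab c; have := grep_lab d; rewrite size_cat.
    by case: (glab c) => //; case: (glab d) => //= ? ? ? ?; rewrite addnS.
  have us : uniq (hpts (Hact b h)) by rewrite -(perm_uniq ts).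
  have Ets := perm_mem ts => s0.
  have hb : grep b \in [:: 0; a] by rewrite [_ \in _]Ets mem_cat grep_lab.
  have hr : hrep h \in [:: 0; a].
    by rewrite [_ \in _]Ets mem_cat (hlab_pts (hrep_lab h)) orbT.
  case: (uniq_catP us (grep_lab b)).
  move: hb hr s0; rewrite !inE mem_cat negb_or.
  case/orP=> /eqP eb; first by rewrite -eb grep_lab.
  case/orP=> /eqP er; first by rewrite -er hrep_lab andbF.
  by rewrite eb -er (hlab_pts (hrep_lab h)).
have us : uniq (hpts s) by rewrite -(perm_uniq ts).
have Ets := perm_mem ts.
have ot : hincr (Hact (Gleaf a) t).
  by move: nt => /=; elim: (t) => //= [[]//|[]].
(* The labels are the nonzero points. *)
have Elab : hlab (Hact (Gleaf a) t) =i hlab s.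
  move=> x; apply/idP/idP => xl.
    apply: hpts_lab; first by rewrite -Ets hlab_pts.
    by apply: contraNneq t0 => <-.
  apply: hpts_lab; first by rewrite Ets hlab_pts.
  by apply: contraNneq s0 => <-.
have Emin := hmin_eq ot os Elab.
(* The smallest label is compared first, and more letters m, n make a word smaller. *)
have height_min : height s (hmin s) < height (Hact (Gleaf a) t) (hmin s) ->
    path_less (hlab (Hact (Gleaf a) t)) (hpath (Hact (Gleaf a) t)) (hpath s).
  move=> lt; exists (hmin s); split; first by rewrite Elab hmin_lab.
    move=> y yt yl; have := hmin_min os; move=> /(_ y); rewrite -Elab yt => /(_ isT).
    by rewrite leqNgt yl.
  by apply: word_lt_mn; rewrite !size_word_mn_hpath.
case: s ts est us s0 os C Ets Elab Emin height_min => [q /perm_size|b|b h] /=.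
- by have := hend_pts t; case: (hpts t).
(* For [s] of the form i(b) all heights are 0, while those in [t] are positive. *)
- by move=> ts _ _ _ _ _ _ _ _ lt; right; apply: lt; case: ifP.
move=> ts est us s0 os C Ets Elab Emin height_min.
have [ub uh] : uniq (glab b) /\ uniq (hpts h).
  by move: us; rewrite cat_uniq => /and3P[].
have /= /andP[an ut'] := ut.
have Ds := uniq_catP us.
have [Cb Ch _] : [/\ gcrossed (hedge (Hact (Gleaf a) t)) b,
  hcrossed (hedge (Hact (Gleaf a) t)) h
  & crossing (hedge (Hact (Gleaf a) t)) (glab b) (hpts h)] := C.
have clos := hcrossed_next (fun x y y' => @hedge_next _ x y y' ut) uh Ch.
have {}clos := clos (fun y => etrans (congr1 (fun z => hedge _ z y) (esym est)) (hedge_end y ut)).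
(* The points of [h] are closed under successors; with the first label they would be all points. *)
have anh : a \notin hpts h.
  apply/negP => ah.
  have full := @hedge_up (Hact (Gleaf a) t) (mem (hpts h)) nt ut.
  have {}full := full (fun y ys ye => clos y ys (eq_ind (hend t) (fun z => y != z) ye (hend h) est)) ah.
  have bt : grep b \in hpts (Hact (Gleaf a) t) by rewrite [_ \in _]Ets mem_cat grep_lab.
  exact: (Ds _ (grep_lab b) (full _ bt)).
have ab : a \in glab b.
  by have := Ets a; rewrite inE eqxx mem_cat (negbTE anh) orbF.
have t0' : 0 \notin hlab t by move: t0; rewrite /= inE negb_or => /andP[].
have h0 : 0 \notin hlab h by move: s0; rewrite mem_cat negb_or => /andP[].
have /andP[ob oh] := os.
have ot' : hincr t := ot.
(* A single label as first block is [a] itself: both trees begin with the same letter, and the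
   comparison passes to what [a] acts on. *)
case: b ts us s0 os C Ets Elab Emin height_min ub Ds Cb ab ob => [c|b1 b2] ts us s0 os C Ets Elab Emin height_min ub Ds Cb ab ob.
  move: ab ts C {Ets Elab Emin height_min us s0 os Ds Cb ub ob}; rewrite inE => /eqP <- /=.
  rewrite perm_cons => ts [_ Ct _].
  have lab x : x \in hlab t = (x \in hlab h).
    apply/idP/idP => xl.
      apply: hpts_lab; first by rewrite -(perm_mem ts) hlab_pts.
      by apply: contraNneq t0' => <-.
    apply: hpts_lab; first by rewrite (perm_mem ts) hlab_pts.
    by apply: contraNneq h0 => <-.
  have letter : act_letter (Gleaf a) t = act_letter (Gleaf a) h.
    by rewrite /act_letter (hmin_eq ot' oh lab).
  have mnl : in_mn (act_letter (Gleaf a) h) by rewrite /act_letter; case: ifP.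
  have sub : {subset hpts h <= hpts t} by move=> x; rewrite (perm_mem ts).
  case: (IH h ut' t0' h0 nt oh ts est (hedge_act_mono ut sub Ct)) => [->|less]; first by left.
  right; apply: (@first_lt_catr [:: a] (hlab t)).
    have nota x : x \in hlab t -> (x \in [:: a]) = false.
      by move=> xt; rewrite inE; apply: contraNF an => /eqP<-; rewrite hlab_pts.
    apply: first_lt_mono less => x /nota /= ->; rewrite letter.
      exact: word_nf_cons.
    by rewrite word_lt_cons.
  by left => x ax /=; rewrite ax letter.
right; pose b := Gbr b1 b2; rewrite -/b in ts us s0 os C Ets Elab Emin height_min ub Ds Cb ab ob *.
(* The block also contains the second label of the path: otherwise [h] would contain everything
   after [a], leaving only [a] for a block of at least two labels. *)
have rb : hrep t \in glab b.
  have : hrep t \in glab b ++ hpts h by rewrite -Ets inE (hlab_pts (hrep_lab t)) orbT.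
  rewrite mem_cat => /orP[//|rh].
  have full : {subset hpts t <= hpts h}.
    have ae x : x \in hpts h -> x != a by move=> xh; apply: contraNneq anh => <-.
    apply: (@hedge_up t (mem (hpts h))) => // x xh; rewrite est => /(clos x xh) [y yh].
    by case/orP=> [e|/andP[/eqP xa _]]; [exists y|have := ae x xh; rewrite xa eqxx].
  have ba : {subset glab b <= [:: a]}.
    move=> x xb; have := Ets x; rewrite mem_cat xb !inE => /orP[//|/full xh].
    by case: (Ds x).
  have := uniq_leq_size ub ba; rewrite /= size_cat.
  have := grep_lab b1; have := grep_lab b2.
  by case: (glab b1) => // ? ?; case: (glab b2) => //= ? ? _ _; rewrite addnS.
have height_lt x : x \in glab b ++ hlab h -> x != a ->
    (if x \in glab b then 1 else (height h x).+1) < (if x \in [:: a] then 1 else (height t x).+1).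
  move=> xs xa; rewrite inE (negbTE xa).
  (* The first block takes the two labels [a] and [c] for one letter, and [height_le] handles what
     lies after them. Shorter paths leave no label for [h]. *)
  case: t rb clos est ts C Ets Elab Emin height_min nt an ut' ut ot ot' t0 t0' IH Cb Ch =>
    [p|[c|//]|[c|//] t] rb clos est ts C Ets Elab Emin height_min nt an ut' ut ot ot' t0 t0' IH Cb Ch.
  - by case: (Ds p) => //; rewrite -[p]/(hend (Hleaf p)) est hend_pts.
  - have sub : {subset hlab h <= [::]}.
      move=> y yh; have := Elab y; rewrite mem_cat yh orbT !inE => /orP[/eqP ya|/eqP yc].
        by rewrite -ya (hlab_pts yh) in anh.
      by case: (Ds y); rewrite ?hlab_pts // yc.
    by have := sub _ (hrep_lab h).
  have nh : {subset hpts h <= hpts t}.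
    move=> y yh; have := Ets y; rewrite mem_cat yh orbT !inE => /or3P[/eqP ya|/eqP yc|//].
      by rewrite -ya yh in anh.
    by case: (Ds y); rewrite // yc.
  have nh' : {subset hpts h <= hpts (Hact (Gleaf c) t)}.
    by move=> y /nh yt; rewrite inE yt orbT.
  have [cn uht] : c \notin hpts t /\ uniq (hpts t) by move: ut' => /= /andP[].
  case: ifP => [_|xb] /=; first by rewrite ltnS; case: ifP.
  have xh : x \in hlab h by move: xs; rewrite mem_cat xb.
  have -> : (x \in [:: c]) = false.
    by rewrite inE; apply: contraNF cn => /eqP<-; apply/nh/hlab_pts.
  rewrite !ltnS; apply: (@height_le t h) => //.
  by apply: (hedge_act_mono ut') => //; apply: (hedge_act_mono ut).
have [ma|ma] := eqVneq (hmin (Hact b h)) a; last first.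
  by apply: height_min; apply: height_lt => //; exact: (hmin_lab (Hact b h)).
(* If [a] is the smallest label, its word is m in [t] and m followed by at least one beta in [s]. *)
exists a; split; first by rewrite inE eqxx.
  move=> y yt; rewrite ltnNge -ma (hmin_min (h := Hact b h)) //= -Elab //.
rewrite inE eqxx ab.
have min_t : hmin (Hact (Gleaf a) t) = a := etrans Emin ma.
have -> : act_letter (Gleaf a) t = Gm.
  rewrite /act_letter [grep _]/= ltn_neqAle.
  have -> : a != hmin t by apply: contraNneq an => ->; exact/hlab_pts/hmin_lab.
  by have := geq_minr a (hmin t); rewrite [minn _ _]min_t => ->.
have gb : grep b = a.
  apply/eqP; rewrite eqn_leq (grep_min ob ab).
  by have := geq_minl (grep b) (hmin h); rewrite -[minn _ _]/(hmin (Hact b h)) ma.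
have -> : act_letter b h = Gm.
  rewrite /act_letter gb ltn_neqAle.
  have -> : a != hmin h by apply: contraNneq anh => ->; exact/hlab_pts/hmin_lab.
  by have := geq_minr (grep b) (hmin h); rewrite -[minn _ _]/(hmin (Hact b h)) ma => ->.
rewrite word_lt_cons //; apply: word_lt_bi.
  by rewrite !word_mn_gpath.
by rewrite !word_bi_gpath !size_nseq.
Qed.

End WordOrder.

End ModuleTrees.

(** * Grafting and homogeneity *)

Section Grafting.
Variable S : signature.
Local Open Scope nat_scope.
Implicit Types (a b t : tree S) (sigma : colour S -> nat -> tree S).

Lemma leaves_graft sigma a :
  leaves (graft sigma a) = flatten [seq leaves (sigma z.1 z.2) | z <- leaves a].
Proof.
elim/tree_nested_ind: a => [c j|g ts IH] /=; first by rewrite cats0.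
rewrite -map_comp; elim: ts IH => //= t ts IHts [-> /IHts ->].
by rewrite map_cat flatten_cat.
Qed.

Lemma labels_graft sigma a :
  labels (graft sigma a) = flatten [seq labels (sigma z.1 z.2) | z <- leaves a].
Proof. by rewrite /labels leaves_graft map_flatten -map_comp. Qed.

Lemma leaves_relabel f b :
  leaves (relabel f b) = [seq (z.1, f z.2) | z <- leaves b].
Proof.
rewrite leaves_graft; by elim: (leaves b) => //= z s ->.
Qed.

Lemma labels_relabel f b : labels (relabel f b) = map f (labels b).
Proof. by rewrite /labels leaves_relabel -!map_comp. Qed.

Lemma labels_node g ts : labels (Node g ts) = flatten (map (@labels S) ts).
Proof. by rewrite /labels /= map_flatten -map_comp. Qed.

Lemma coloured_labels a : coloured a -> 0 < size (labels a).
Proof.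
elim/tree_nested_ind: a => //= g ts IH /andP[/eqP gi].
case: ts IH gi => [_ gi|t ts /= [IHt _] _ /andP[/IHt]].
  by have := gin_neq0 g; rewrite -gi.
by rewrite labels_node /= size_cat => /leq_trans H _; apply/H/leq_addr.
Qed.

Lemma minlab_mem a : 0 < size (labels a) -> minlab a \in labels a.
Proof.
rewrite /minlab; case: (labels a) => //= x s _.
have : foldr minn x s \in x :: s.
  elim: s => /= [|y s IH]; first exact: mem_head.
  rewrite {1}/minn; case: ifP => _; first by rewrite !inE eqxx orbT.
  by move: IH; rewrite !inE => /orP[->|->]; rewrite ?orbT.
by rewrite {2}/minn; case: ifP => // _ _; exact: mem_head.
Qed.

Lemma minlab_le a x : x \in labels a -> minlab a <= x.
Proof.
rewrite /minlab; elim: (labels a) (head 0 _) => //= y s IH z.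
by rewrite inE geq_min => /orP[/eqP->|/(IH z)->]; rewrite ?leqnn ?orbT.
Qed.

Lemma minlab_spec a m : m \in labels a -> {in labels a, forall x, m <= x} ->
  minlab a = m.
Proof.
move=> ma min; apply/eqP; rewrite eqn_leq minlab_le //=; apply/min/minlab_mem.
by case: (labels a) ma.
Qed.

Section GraftMonotone.
Variables (sigma : colour S -> nat -> tree S) (phi : nat -> nat).

(** The shuffle condition sees a grafted tree only through its smallest label. In a shuffle
    composition [phi] is [f], including at the leaf [l]. *)
Definition graft_minlab a :=
  {in leaves a, forall z, 0 < size (labels (sigma z.1 z.2)) /\
                          minlab (sigma z.1 z.2) = phi z.2}.

Lemma minlab_graft a : 0 < size (labels a) -> graft_minlab a ->
  {in labels a &, {homo phi : x y / x <= y}} ->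
  minlab (graft sigma a) = phi (minlab a).
Proof.
move=> a0 ga mono; apply: minlab_spec; rewrite labels_graft.
  have /mapP[z za ->] := minlab_mem a0.
  have [p0 <-] := ga z za; apply/flatten_mapP; exists z => //.
  exact: minlab_mem.
move=> x /flatten_mapP[z za xz]; have [_ e] := ga z za.
apply: leq_trans (minlab_le xz); rewrite e.
have zl : z.2 \in labels a by apply: map_f.
by apply: mono => //; [exact: minlab_mem|exact: minlab_le].
Qed.

(** The smallest labels of the inputs of a vertex are transported by the increasing map [phi], so
    they stay in order. *)
Lemma shuffled_graft a : coloured a -> graft_minlab a ->
  {in leaves a, forall z, shuffled (sigma z.1 z.2)} ->
  {in labels a &, {homo phi : x y / x < y}} ->
  shuffled a -> shuffled (graft sigma a).
Proof.
elim/tree_nested_ind: a => [c j _ _ h _ _|g ts IH].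
  by apply: (h (c, j)); rewrite inE.
move=> /= /andP[_ ct] gs hs mono /andP[so st]; apply/andP; split.
  have -> : [seq minlab i | i <- [seq graft sigma i | i <- ts]]
      = map phi (map (@minlab S) ts).
    rewrite -!map_comp; apply/eq_in_map => t tts /=; apply: minlab_graft.
    - by apply: coloured_labels; apply: (allP ct).
    - by move=> z zt; apply: gs; apply/flatten_mapP; exists t.
    - move=> x y xt yt; rewrite leq_eqVlt => /orP[/eqP->//|xy].
      apply/ltnW/mono => //; rewrite labels_node; apply/flatten_mapP; by exists t.
  have sub : {subset map (@minlab S) ts <= labels (Node g ts)}.
    move=> x /mapP[t tts ->]; rewrite labels_node; apply/flatten_mapP.
    exists t => //; apply/minlab_mem/coloured_labels; exact: (allP ct).
  elim: (map (@minlab S) ts) so sub => //= x s IHs.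
  rewrite !(path_sortedE ltn_trans) => /andP[xs ss] sub.
  rewrite IHs //; last by move=> y ys; apply: sub; rewrite inE ys orbT.
  rewrite andbT; apply/allP => _ /mapP[y ys ->].
  by apply: mono; rewrite ?sub ?inE ?eqxx ?ys ?orbT //; exact: (allP xs).
have sub t : t \in ts -> {subset leaves t <= leaves (Node g ts)}.
  by move=> tts z zt; apply/flatten_mapP; exists t.
have {}mono t : t \in ts -> {in labels t &, {homo phi : x y / x < y}}.
  move=> tts x y /mapP[z zt ->] /mapP[u ut ->]; apply: mono.
    by apply: map_f; apply: (sub t).
  by apply: map_f; apply: (sub t).
rewrite all_map; apply/allP => t tts /=.
have {}IH : forall t, t \in ts -> coloured t -> graft_minlab t ->
  {in leaves t, forall z, shuffled (sigma z.1 z.2)} ->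
  {in labels t &, {homo phi : x y / x < y}} ->
  shuffled t -> shuffled (graft sigma t).
  elim: (ts) IH => //= u us IHus [IHu /IHus h] v; rewrite inE => /orP[/eqP->//|]; exact: h.
apply: IH => //; [exact: (allP ct)| | |exact: mono|exact: (allP st)].
  by move=> z /(sub t tts) /gs.
by move=> z /(sub t tts) /hs.
Qed.

End GraftMonotone.

Lemma coloured_graft sigma a :
  {in leaves a, forall z, coloured (sigma z.1 z.2) && (tout (sigma z.1 z.2) == z.1)} ->
  coloured a -> coloured (graft sigma a) && (tout (graft sigma a) == tout a).
Proof.
elim/tree_nested_ind: a => [c j h _|g ts IH h] /=.
  by apply: (h (c, j)); rewrite inE.
case/andP=> /eqP gi cts; rewrite eqxx andbT -gi -!map_comp.
have {}IH : forall t, t \in ts -> coloured (graft sigma t) && (tout (graft sigma t) == tout t).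
  elim: (ts) IH h cts {gi} => //= t us IHus [IHt IHu] h /andP[ct cus] v.
  rewrite inE => /orP[/eqP->|].
    by apply: IHt => // z zt; apply: h; rewrite /= mem_cat zt.
  by apply: IHus => // z zt; apply: h; rewrite /= mem_cat orbC; apply/orP; left.
apply/andP; split.
  by apply/eqP/eq_in_map => t /IH/andP[_ /eqP].
by rewrite all_map; apply/allP => t /IH/andP[].
Qed.

Lemma sorted_map_homo f p : sorted ltn (map f (iota 1 p)) ->
  {in iota 1 p &, {homo f : x y / x < y}}.
Proof.
move=> so x y; rewrite !mem_iota !add1n => /andP[x1 xp] /andP[y1 yp] xy.
have := @sorted_ltn_nth _ ltn ltn_trans 0 _ so x.-1 y.-1.
rewrite !inE size_map size_iota !(nth_map 0) ?size_iota ?nth_iota ?add1n; try lia.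
by rewrite !prednK //; apply; lia.
Qed.

Lemma labels_inputs (chi : seq (colour S)) : map snd (inputs chi) = iota 1 (size chi).
Proof. by rewrite /inputs -/unzip2 unzip2_zip // size_iota. Qed.

Lemma size_inputs (chi : seq (colour S)) : size (inputs chi) = size chi.
Proof. by rewrite /inputs size_zip size_iota minnn. Qed.

Lemma monomial_labels chi c a : monomial_in chi c a ->
  perm_eq (labels a) (iota 1 (size chi)).
Proof.
by case/and3P=> _ la _; rewrite -labels_inputs; apply: perm_map.
Qed.

Lemma uniq_snd_inj (T : eqType) (s : seq (T * nat)) z u :
  uniq (map snd s) -> z \in s -> u \in s -> z.2 = u.2 -> z = u.
Proof.
elim: s => //= v s IH /andP[vs us]; rewrite !inE.
case/orP=> [/eqP->|zs]; case/orP=> [/eqP-> //|us'] e.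
- by case/negP: vs; rewrite e map_f.
- by case/negP: vs; rewrite -e map_f.
- exact: IH.
Qed.

Lemma monomial_tcompose l f g chi1 c1 chi2 c2 chi a b :
  monomial_in chi1 c1 a -> monomial_in chi2 c2 b ->
  composable l f g chi1 chi2 c2 chi ->
  monomial_in chi c1 (tcompose l f g a b).
Proof.
move=> ma mb /and3P[lin /and5P[lp sf sg /eqP fl _] pchi].
have la := monomial_labels ma; have lb := monomial_labels mb.
have /and3P[/and3P[ca sa _] pa /eqP oa] := ma.
have /and3P[/and3P[cb sb _] pb /eqP ob] := mb.
have monof : {in labels a &, {homo f : x y / x < y}}.
  by move=> x y; rewrite !(perm_mem la); apply: sorted_map_homo.
have monog : {in labels b &, {homo g : x y / x < y}}.
  by move=> x y; rewrite !(perm_mem lb); apply: sorted_map_homo.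
have uin : uniq (map snd (inputs chi1)) by rewrite labels_inputs iota_uniq.
have lcol z : z \in leaves a -> z.2 = l -> z = (c2, l).
  by rewrite (perm_mem pa) => zi zl; apply: uniq_snd_inj uin zi lin zl.
have b0 : 0 < size (labels b) by exact: coloured_labels.
have n2 : 0 < size chi2 by rewrite -(size_iota 1 (size chi2)) -(perm_size lb).
have gsb : graft_minlab (fun c j => Leaf c (g j)) g b.
  by move=> z _; split=> //; apply: minlab_spec; rewrite ?inE // => x; rewrite inE => /eqP->.
have min_b : minlab b = 1.
  apply: minlab_spec; first by rewrite (perm_mem lb) mem_iota.
  by move=> x; rewrite (perm_mem lb) mem_iota => /andP[].
have rel_b : coloured (relabel g b) && (tout (relabel g b) == c2).
  rewrite -ob; apply: coloured_graft => // z _ /=; exact: eqxx.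
have homog : {in labels b &, {homo g : x y / x <= y}}.
  move=> x y xb yb; rewrite leq_eqVlt => /orP[/eqP->//|xy].
  exact/ltnW/monog.
(* At [l] this is the condition [f l = g 1], because 1 is the smallest label of [b]. *)
have gsa : graft_minlab (fun c j => if j == l then relabel g b else Leaf c (f j)) f a.
  move=> z za; case: eqP => [zl|_].
    rewrite labels_relabel size_map; split=> //.
    by rewrite (minlab_graft b0 gsb homog) min_b zl fl.
  by split=> //; apply: minlab_spec; rewrite ?inE // => x; rewrite inE => /eqP->.
have leaves_c : perm_eq (leaves (tcompose l f g a b)) (inputs chi).
  apply: perm_trans pchi; rewrite /tcompose leaves_graft.
  have pr : perm_eq (leaves a) ((c2, l) :: rem (c2, l) (inputs chi1)).
    exact: perm_trans pa (perm_to_rem lin).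
  rewrite (perm_trans (perm_flatten (perm_map _ pr))) //= eqxx perm_catC.
  apply: perm_cat; last by rewrite leaves_relabel; apply: perm_map.
  have : {in rem (c2, l) (inputs chi1), forall z, z.2 != l}.
    move=> z zr; apply: contraTneq zr => zl.
    have ui : uniq (inputs chi1) by apply: map_uniq uin.
    rewrite (mem_rem_uniq _ ui) inE; apply/negP => /andP[/eqP zn zi]; apply: zn.
    exact: uniq_snd_inj uin zi lin zl.
  elim: (rem _ _) => //= z s IHs h; rewrite (negbTE (h z _)) ?mem_head // perm_cons.
  by apply: IHs => u us; apply: h; rewrite inE us orbT.
have /andP[cc oc] : coloured (tcompose l f g a b) && (tout (tcompose l f g a b) == tout a).
  apply: coloured_graft => // z za; case: eqP => [zl|_] /=; last exact: eqxx.
  by rewrite (lcol z za zl).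
apply/and3P; split=> //; last by rewrite (eqP oc) oa.
apply/and3P; split=> //.
  apply: (shuffled_graft (phi := f)) => // z za; case: ifP => // _.
  exact: (shuffled_graft (phi := g)).
by rewrite /labels /arity (perm_size leaves_c) size_inputs -labels_inputs; apply: perm_map.
Qed.

End Grafting.

Section Support.
Variables (k : fieldType) (S : signature).
Local Notation elt := {malg k[tree S]}.

Lemma msupp_mcompose l f g (x y : elt) t : t \in msupp (mcompose l f g x y) ->
  exists a b, [/\ a \in msupp x, b \in msupp y & t = tcompose l f g a b].
Proof.
pose P (z : elt) := t \in msupp z ->
  exists a b, [/\ a \in msupp x, b \in msupp y & t = tcompose l f g a b].
have P0 : P 0 by rewrite /P msupp0 inE.
have PD z1 z2 : P z1 -> P z2 -> P (z1 + z2).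
  by move=> h1 h2 /(fsubsetP (msuppD_le _ _)); rewrite inE => /orP[/h1|/h2].
rewrite -/(P _) /mcompose big_seq; apply: big_ind => // a ax.
rewrite big_seq; apply: big_ind => // b bx.
by move=> /(fsubsetP msuppU_le); rewrite inE => /eqP->; exists a, b.
Qed.

Lemma ideal_gen_homogeneous (R : elt -> Prop) chi c x :
  ideal_gen R chi c x -> homogeneous chi c x.
Proof.
elim=> {chi c x} [chi c x _ //|chi c t|chi c r x y _ hx _ hy t|
    l f g chi1 c1 chi2 c2 chi x y _ hx hy comp t|
    l f g chi1 c1 chi2 c2 chi x y hx _ hy comp t].
- by rewrite msupp0 inE.
- move=> /(fsubsetP (msuppD_le _ _)); rewrite inE => /orP[|/hy//].
  by move=> /(fsubsetP (msuppZ_le _ _)) /hx.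
- move=> /msupp_mcompose[a [b [/hx ma /hy mb ->]]].
  exact: monomial_tcompose comp.
- move=> /msupp_mcompose[a [b [/hx ma /hy mb ->]]].
  exact: monomial_tcompose comp.
Qed.

End Support.

(** * The value of a monomial *)

Section Valuation.
Variable k : fieldType.
Local Notation atree := (tree AffHS_sig).
Implicit Types (w : nat -> nat -> k) (t : atree).

Definition cross w (A B : seq nat) : k := \sum_(x <- A) \sum_(y <- B) w x y.

Definition join_pts (g : affgen) (ps : seq (seq nat)) : seq nat :=
  (if g is Gi then [:: 0%N] else [::]) ++ flatten ps.

Fixpoint pts t : seq nat :=
  match t with Leaf _ j => [:: j] | Node g ts => join_pts g (map pts ts) end.

(** For antisymmetric [w] the sign at m makes m and n agree: both give minus the sum from the acting
    side to the side acted on. Wrong numbers of inputs get the default 0. *)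
Definition vertex_val w (g : affgen) (ps : seq (seq nat)) : k :=
  match g, ps with
  | Gi, [:: A] => cross w A [:: 0%N]
  | Gbeta, [:: A; B] => cross w A B
  | Gm, [:: A; B] => - cross w A B
  | Gn, [:: A; B] => cross w A B
  | _, _ => 0
  end.

Fixpoint treeval w t : k :=
  match t with
  | Leaf _ _ => 1
  | Node g ts => vertex_val w g (map pts ts) * \prod_(v <- map (treeval w) ts) v
  end.

Definition antisymmetric_weight w : Prop := forall x y, w y x = - w x y.

Lemma cross_flatten w (F : nat -> seq nat) A B :
  cross w (flatten (map F A)) (flatten (map F B))
    = cross (fun x y => cross w (F x) (F y)) A B.
Proof.
rewrite /cross big_flatten big_map; apply: eq_bigr => x _.
under [LHS]eq_bigr => u _ do rewrite big_flatten big_map.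
by rewrite exchange_big.
Qed.

Lemma eq_cross w w' A B : w =2 w' -> cross w A B = cross w' A B.
Proof. by move=> e; apply: eq_bigr => x _; apply: eq_bigr => y _. Qed.

Lemma perm_cross w A A' B B' : perm_eq A A' -> perm_eq B B' ->
  cross w A B = cross w A' B'.
Proof.
move=> pA pB; rewrite /cross (perm_big _ pA); apply: eq_bigr => x _.
exact: perm_big.
Qed.

Lemma cross_anti w A B : antisymmetric_weight w -> cross w B A = - cross w A B.
Proof.
move=> aw; rewrite /cross exchange_big -sumrN; apply: eq_bigr => x _.
by rewrite -sumrN; apply: eq_bigr => y _.
Qed.

Lemma cross_catl w A A' B : cross w (A ++ A') B = cross w A B + cross w A' B.
Proof. by rewrite /cross big_cat. Qed.

Lemma cross_catr w A B B' : cross w A (B ++ B') = cross w A B + cross w A B'.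
Proof. by rewrite /cross -big_split; apply: eq_bigr => x _; rewrite big_cat. Qed.

Lemma eq_vertex_val w w' g ps : w =2 w' -> vertex_val w g ps = vertex_val w' g ps.
Proof.
by move=> e; case: g ps => [] [|A [|B [|]]] //=; rewrite (eq_cross _ _ e).
Qed.

Lemma eq_val w w' t : w =2 w' -> treeval w t = treeval w' t.
Proof.
move=> e; elim/tree_nested_ind: t => //= g ts IH; rewrite (eq_vertex_val _ _ e).
congr (_ * _); rewrite !big_map.
by elim: ts IH => [|t ts IHts] //=; rewrite ?big_nil // !big_cons => -[-> /IHts->].
Qed.

Section Graft.
Variables (w : nat -> nat -> k) (sigma : colour AffHS_sig -> nat -> atree)
  (F : nat -> seq nat).
Hypothesis F0 : F 0 = [:: 0%N].

Lemma pts_graft t :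
  {in leaves t, forall z, pts (sigma z.1 z.2) = F z.2} ->
  pts (graft sigma t) = flatten (map F (pts t)).
Proof.
elim/tree_nested_ind: t => [c j h|g ts IH h] /=.
  by rewrite cats0 (h (c, j)) ?inE.
rewrite /join_pts map_cat flatten_cat; congr (_ ++ _).
  by case: g {h} => //=; rewrite F0.
rewrite map_flatten -!map_comp; elim: ts IH h => //= t ts IHts [IHt IHu] h.
rewrite flatten_cat IHts // => [|z zt]; last by apply: h; rewrite mem_cat zt orbT.
by congr (_ ++ _); apply: IHt => z zt; apply: h; rewrite mem_cat zt.
Qed.

(** The vertices of the outer tree see the block [F x] in place of the point [x]; those of the
    grafted trees see the same points as before. *)
Lemma val_graft t :
  {in leaves t, forall z, pts (sigma z.1 z.2) = F z.2} ->
  treeval w (graft sigma t) = treeval (fun x y => cross w (F x) (F y)) t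
    * \prod_(z <- leaves t) treeval w (sigma z.1 z.2).
Proof.
set w' := (X in treeval X t).
elim/tree_nested_ind: t => [c j h|g ts IH h] /=.
  by rewrite big_seq1 mul1r.
have -> : vertex_val w g (map pts (map (graft sigma) ts)) = vertex_val w' g (map pts ts).
  have -> : map pts (map (graft sigma) ts) = map (fun A => flatten (map F A)) (map pts ts).
    rewrite -!map_comp; apply/eq_in_map => t tts /=; apply: pts_graft => z zt.
    by apply: h; apply/flatten_mapP; exists t.
  have c0 A : cross w (flatten (map F A)) [:: 0%N] = cross w' A [:: 0%N].
    by rewrite -cross_flatten /= F0.
  by case: g {h} (map pts ts) => [] [|A [|B [|]]] //=; rewrite ?c0 // cross_flatten.
rewrite -mulrA; congr (_ * _); rewrite big_flatten !big_map -big_split /=.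
elim: ts IH h => [|t ts IHts] /=; first by rewrite !big_nil.
move=> [IHt IHu] h; rewrite !big_cons IHts // => [|z zt].
  congr (_ * _); apply: IHt => z zt; apply: h; by rewrite mem_cat zt.
by apply: h; rewrite mem_cat zt orbT.
Qed.

End Graft.

(** A relabelling has to keep the additional point, while [g 0] is arbitrary. *)
Definition extend0 (g : nat -> nat) (x : nat) : nat := if x == 0%N then 0%N else g x.

Fixpoint count_i t : nat :=
  match t with
  | Leaf _ _ => 0
  | Node g ts => (((g : affgen) == Gi) + sumn (map count_i ts))%N
  end.

Lemma pts_labels t : perm_eq (pts t) (labels t ++ nseq (count_i t) 0%N).
Proof.
apply/permP => p; rewrite count_cat count_nseq.
elim/tree_nested_ind: t => [c j|g ts IH] /=; first by rewrite muln0 !addn0.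
rewrite labels_node /join_pts count_cat !count_flatten.
have -> : sumn (map (count p) (map pts ts))
    = (sumn (map (count p) (map (@labels AffHS_sig) ts)) + p 0 * sumn (map count_i ts))%N.
  by elim: ts IH => [|t ts IHts] /=; [rewrite muln0|move=> [-> /IHts ->]; rewrite mulnDr addnACA].
rewrite mulnDr addnCA; congr (_ + (_ + _))%N.
by case: g => /=; rewrite ?muln0 ?muln1 ?addn0.
Qed.

(* The module colour is carried by exactly one leaf or one vertex i. *)
Lemma count_i_spec t : coloured t ->
  (count_mem Ch [seq z.1 | z <- leaves t] + count_i t = (tout t == Ch))%N.
Proof.
elim/tree_nested_ind: t => [c j _|g ts IH] /=; first by rewrite !addn0.
case/andP=> /eqP gi /= cts.
have -> : (count_mem Ch [seq z.1 | z <- flatten (map (@leaves AffHS_sig) ts)]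
    + (((g : affgen) == Gi) + sumn (map count_i ts))
    = ((g : affgen) == Gi) + count_mem Ch (map (@tout AffHS_sig) ts))%N.
  elim: ts IH cts {gi} => [|t ts IHts] /=; first by rewrite addn0.
  move=> [IHt IHu] /andP[ct cts].
  rewrite map_cat count_cat -IHt //; have := IHts IHu cts.
  move: (nat_of_bool _) (count _ (map _ (flatten _))) (count _ (map _ (leaves t))).
  by move: (count _ _) (sumn _) (count_i t) => *; lia.
by rewrite gi; case: g {gi}.
Qed.

(** By [count_i_spec] this is the number of vertices i, hence of additional points, in every
    monomial with these colours. *)
Definition phantoms (chi : seq affcol) (c : affcol) : nat :=
  ((c == Ch) - count_mem Ch [seq z.1 | z <- @inputs AffHS_sig chi])%N.

Lemma pts_monomial chi c t : monomial_in chi c t ->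
  perm_eq (pts t) (iota 1 (size chi) ++ nseq (phantoms chi c) 0%N).
Proof.
move=> m; rewrite (perm_trans (pts_labels t)) //.
have -> : count_i t = phantoms chi c.
  case/and3P: m => [/andP[ct _] pt /eqP <-].
  by rewrite /phantoms -(count_i_spec ct) (permP (perm_map _ pt)) addKn.
by rewrite perm_cat2r (monomial_labels m).
Qed.

Lemma labels_monomial_neq0 chi c t : monomial_in chi c t -> 0%N \notin labels t.
Proof. by move=> m; rewrite (perm_mem (monomial_labels m)) mem_iota. Qed.

(** The block that replaces [x] in a composition. It is built from the colours of the second factor
    alone, so it is the same for all monomials of that factor. *)
Definition insert_pts (l : nat) (f g : nat -> nat) chi2 c2 (x : nat) : seq nat :=
  if x == 0%N then [:: 0%N]
  else if x == l then map (extend0 g) (iota 1 (size chi2) ++ nseq (phantoms chi2 c2) 0%N)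
  else [:: f x].

Lemma pts_relabel g b : 0%N \notin labels b ->
  pts (relabel g b) = map (extend0 g) (pts b).
Proof.
move=> b0; rewrite (pts_graft (F := fun x => [:: extend0 g x])) //.
  by elim: (pts b) => //= x s ->.
move=> z zb /=; rewrite /extend0; case: eqP => // z0.
by case/negP: b0; rewrite -z0 map_f.
Qed.

Lemma val_relabel w g b : 0%N \notin labels b ->
  treeval w (relabel g b) = treeval (fun x y => w (extend0 g x) (extend0 g y)) b.
Proof.
move=> b0; rewrite (val_graft w (F := fun x => [:: extend0 g x])) //; last first.
  move=> z zb /=; rewrite /extend0; case: eqP => // z0.
  by case/negP: b0; rewrite -z0 map_f.
rewrite [X in _ * X]big1 // mulr1; apply: eq_val => x y.
by rewrite /cross !big_seq1.
Qed.

Lemma val_tcompose w l f g chi1 c1 chi2 c2 chi a b :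
  monomial_in chi1 c1 a -> monomial_in chi2 c2 b ->
  composable l f g chi1 chi2 c2 chi ->
  treeval w (tcompose l f g a b) =
    treeval (fun x y => cross w (insert_pts l f g chi2 c2 x) (insert_pts l f g chi2 c2 y)) a
    * treeval (fun x y => w (extend0 g x) (extend0 g y)) b.
Proof.
move=> ma mb /and3P[_ /and5P[lp _ _ _ _] _].
have a0 := labels_monomial_neq0 ma; have b0 := labels_monomial_neq0 mb.
have l0 : l != 0%N by move: lp; rewrite mem_iota; case: l.
pose F x := if x == 0%N then [:: 0%N] else if x == l then pts (relabel g b) else [:: f x].
rewrite /tcompose (val_graft w (F := F)) //; last first.
  move=> z za; have z0 : z.2 != 0%N by apply: contraNneq a0 => <-; exact: map_f.
  by rewrite /F (negbTE z0) /=; case: ifP.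
congr (_ * _).
  (* The points of [b] are known only up to order, which is enough for sums. *)
  apply: eq_val => x y; have pF z : perm_eq (F z) (insert_pts l f g chi2 c2 z).
    rewrite /F /insert_pts; case: ifP => // _; case: ifP => // _.
    by rewrite pts_relabel //; apply: perm_map; exact: pts_monomial mb.
  exact: perm_cross.
have la := monomial_labels ma.
have -> : \prod_(z <- leaves a) treeval w (if z.2 == l then relabel g b else @Leaf AffHS_sig z.1 (f z.2))
    = \prod_(j <- labels a) (if j == l then treeval w (relabel g b) else 1).
  by rewrite /labels big_map; apply: eq_bigr => z _; case: ifP.
rewrite (perm_big _ la) (bigD1_seq l) ?iota_uniq //= eqxx val_relabel //.
by rewrite big1 ?mulr1 // => j /negbTE->.
Qed.

Definition lval w (x : {malg k[atree]}) : k := mmap idfun (treeval w) x.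

Lemma lval_lin w (r : k) x y : lval w (r *: x + y) = r * lval w x + lval w y.
Proof.
rewrite /lval mmapD; congr (_ + _).
rewrite (mmapEw (msuppZ_le _ _)) mmapE big_distrr /=.
by apply: eq_bigr => a _; rewrite mcoeffZ mulrA.
Qed.

(** The two new weights do not depend on the monomials, so the factorisation of [val_tcompose]
    extends bilinearly. *)
Lemma lval_mcompose w l f g chi1 c1 chi2 c2 chi x y :
  homogeneous chi1 c1 x -> homogeneous chi2 c2 y ->
  composable l f g chi1 chi2 c2 chi ->
  lval w (mcompose l f g x y) =
    lval (fun u v => cross w (insert_pts l f g chi2 c2 u) (insert_pts l f g chi2 c2 v)) x
    * lval (fun u v => w (extend0 g u) (extend0 g v)) y.
Proof.
move=> hx hy comp; rewrite /lval /mcompose raddf_sum [mmap _ _ x]mmapE mulr_suml.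
rewrite !big_seq; apply: eq_bigr => a ax.
rewrite raddf_sum mmapE mulr_sumr !big_seq; apply: eq_bigr => b bx.
rewrite /= mmapU /= (val_tcompose w (hx a ax) (hy b bx) comp).
by rewrite mulrACA.
Qed.

(** All weights are treated at once because a composition evaluates its factors at weights other
    than [w]. *)
Lemma lval_ideal R chi c x :
  (forall w y, antisymmetric_weight w -> R y -> lval w y = 0) ->
  ideal_gen R chi c x -> forall w, antisymmetric_weight w -> lval w x = 0.
Proof.
move=> h0; elim=> {chi c x} [chi c x Rx _ w aw|chi c w _|chi c r x y _ hx _ hy w aw|
    l f g chi1 c1 chi2 c2 chi x y Ix IH hy comp w aw|
    l f g chi1 c1 chi2 c2 chi x y hx Iy IH comp w aw].
- exact: h0.
- exact: raddf0.
- by rewrite lval_lin hx // hy // mulr0 addr0.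
- rewrite (lval_mcompose w (ideal_gen_homogeneous Ix) hy comp) IH ?mul0r // => u v.
  exact: cross_anti.
- rewrite (lval_mcompose w hx (ideal_gen_homogeneous Iy) comp) [X in _ * X]IH ?mulr0 //.
Qed.

(** * Values of the relations *)

Fixpoint term_pts (u : term) : seq nat :=
  match u with
  | X _ j => [:: j] | I_ v => 0%N :: term_pts v
  | Beta v1 v2 | M_ v1 v2 => term_pts v1 ++ term_pts v2
  end.

Fixpoint term_val w (u : term) : k :=
  match u with
  | X _ _ => 1
  | I_ v => cross w (term_pts v) [:: 0%N] * term_val w v
  | Beta v1 v2 => cross w (term_pts v1) (term_pts v2) * (term_val w v1 * term_val w v2)
  | M_ v1 v2 => - cross w (term_pts v1) (term_pts v2) * (term_val w v1 * term_val w v2)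
  end.

(** The sign from exchanging the arguments of beta cancels against the antisymmetry of [cross]; for
    m and n the sign is built into [vertex_val]. *)
Lemma straighten_val w u : antisymmetric_weight w ->
  perm_eq (pts (straighten u).2) (term_pts u) /\
  (-1) ^+ (straighten u).1 * treeval w (straighten u).2 = term_val w u.
Proof.
move=> aw; elim: u => [c j|v [pv ev]|v1 [p1 e1] v2 [p2 e2]|v1 [p1 e1] v2 [p2 e2]] /=.
- by rewrite mulr1.
- case: (straighten v) pv ev => e t /= pv <-.
  by rewrite /join_pts /= cats0 perm_cons big_seq1 (perm_cross w pv (perm_refl _)) mulrCA.
- case: (straighten v1) (straighten v2) p1 p2 e1 e2 => [e t] [e' t'] /= p1 p2 <- <-.
  case: ifP => _; rewrite /= /join_pts /= cats0 !big_cons big_nil mulr1.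
    split; first exact: perm_cat.
    by rewrite (perm_cross w p1 p2) signr_addb; ring.
  split; first by rewrite perm_catC; exact: perm_cat.
  rewrite (cross_anti _ _ aw) (perm_cross w p1 p2) signrN signr_addb; ring.
- case: (straighten v1) (straighten v2) p1 p2 e1 e2 => [e t] [e' t'] /= p1 p2 <- <-.
  case: ifP => _; rewrite /= /join_pts /= cats0 !big_cons big_nil mulr1.
    split; first exact: perm_cat.
    by rewrite (perm_cross w p1 p2) signr_addb; ring.
  split; first by rewrite perm_catC; exact: perm_cat.
  rewrite (cross_anti _ _ aw) (perm_cross w p1 p2) signr_addb; ring.
Qed.

Lemma lval_sh w u : antisymmetric_weight w -> lval w (sh k u) = term_val w u.
Proof. by move=> aw; rewrite /lval mmapU /=; case: (straighten_val u aw). Qed.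

Lemma lval_sub3 w x y z a b c : lval w x = a -> lval w y = b -> lval w z = c ->
  lval w (x - y - z) = a - b - c.
Proof.
move=> <- <- <-; apply: (etrans (mmapB _ _)); congr (_ - _); exact: mmapB.
Qed.

Lemma lval_addsub w x y z a b c : lval w x = a -> lval w y = b -> lval w z = c ->
  lval w (x + y - z) = a + b - c.
Proof.
move=> <- <- <-; apply: (etrans (mmapB _ _)); congr (_ - _); exact: mmapD.
Qed.

(** With c_ij the sum between the points of the arguments i and j, a common factor multiplies c_12
    (c_13 + c_23) - c_13 (c_12 - c_23) - c_23 (c_12 + c_13) = 0. *)
Lemma lval_lie w u1 u2 u3 : antisymmetric_weight w -> lval w (rel_lie k u1 u2 u3) = 0.
Proof.
move=> aw.
apply: etrans (lval_sub3 (lval_sh _ aw) (lval_sh _ aw) (lval_sh _ aw)) _ => /=.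
rewrite !cross_catl !cross_catr (cross_anti (term_pts u2) (term_pts u3) aw).
move: (cross _ _ _) (cross _ _ _) (cross _ _ _) (term_val _ _) (term_val _ _) => a b c p q.
by move: (term_val _ _) => r; ring.
Qed.

Lemma lval_act w u1 u2 u3 : antisymmetric_weight w -> lval w (rel_act k u1 u2 u3) = 0.
Proof.
move=> aw.
apply: etrans (lval_addsub (lval_sh _ aw) (lval_sh _ aw) (lval_sh _ aw)) _ => /=.
rewrite !cross_catl !cross_catr (cross_anti (term_pts u1) (term_pts u2) aw).
move: (cross _ _ _) (cross _ _ _) (cross _ _ _) (term_val _ _) (term_val _ _) => a b c p q.
by move: (term_val _ _) => r; ring.
Qed.

(** Up to sign this is the identity behind [lval_act], with the additional point as third
    argument. *)
Lemma lval_aff w u1 u2 : antisymmetric_weight w -> lval w (rel_aff k u1 u2) = 0.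
Proof.
move=> aw.
apply: etrans (lval_addsub (lval_sh _ aw) (lval_sh _ aw) (lval_sh _ aw)) _ => /=.
rewrite -(cat1s 0%N (term_pts u1)) -(cat1s 0%N (term_pts u2)).
rewrite !cross_catl !cross_catr (cross_anti (term_pts u1) (term_pts u2) aw).
move: (cross _ _ _) (cross _ _ _) (cross _ _ _) (term_val _ _) (term_val _ _) => a b c p q.
ring.
Qed.

Lemma lval_relation w x : antisymmetric_weight w -> AffHS_relation x -> lval w x = 0.
Proof.
by move=> aw; case=> s _; [exact: lval_lie|exact: lval_act|exact: lval_aff].
Qed.

End Valuation.

(** * Tree monomials of AffHS *)

Section Translation.
Local Open Scope nat_scope.
Local Notation atree := (tree AffHS_sig).

Fixpoint gtree_tree (a : gtree) : atree :=
  match a with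
  | Gleaf j => @Leaf AffHS_sig Cg j
  | Gbr a b => @Node AffHS_sig Gbeta [:: gtree_tree a; gtree_tree b]
  end.

(** One constructor [Hact] covers m and n, since the order of the smallest labels decides between
    them. *)
Fixpoint htree_tree (h : htree) : atree :=
  match h with
  | Hleaf p => @Leaf AffHS_sig Ch p
  | Hinj a => @Node AffHS_sig Gi [:: gtree_tree a]
  | Hact a h =>
      if grep a < hmin h
      then @Node AffHS_sig Gm [:: gtree_tree a; htree_tree h]
      else @Node AffHS_sig Gn [:: htree_tree h; gtree_tree a]
  end.

Lemma labels_gtree a : labels (gtree_tree a) = glab a.
Proof. by elim: a => //= a IHa b IHb; rewrite labels_node /= cats0 IHa IHb. Qed.

Lemma labels_htree h : perm_eq (labels (htree_tree h)) (hlab h).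
Proof.
elim: h => //= [a|a h IH]; first by rewrite labels_node /= cats0 labels_gtree.
case: ifP => _; rewrite labels_node /= cats0 labels_gtree.
  by rewrite perm_cat2l.
by rewrite perm_catC perm_cat2l.
Qed.

Lemma pts_gtree a : pts (gtree_tree a) = glab a.
Proof. by elim: a => //= a IHa b IHb; rewrite /join_pts /= cats0 IHa IHb. Qed.

Lemma pts_htree h : perm_eq (pts (htree_tree h)) (hpts h).
Proof.
elim: h => //= [a|a h IH]; first by rewrite /join_pts /= cats0 pts_gtree.
case: ifP => _; rewrite /= /join_pts /= cats0 pts_gtree.
  by rewrite perm_cat2l.
by rewrite perm_catC perm_cat2l.
Qed.

Lemma minlab_gtree a : gincr a -> minlab (gtree_tree a) = grep a.
Proof.
by move=> oa; apply: minlab_spec; rewrite labels_gtree ?grep_lab //; exact: grep_min.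
Qed.

Lemma minlab_htree h : hincr h -> minlab (htree_tree h) = hmin h.
Proof.
move=> oh; apply: minlab_spec; first by rewrite (perm_mem (labels_htree h)) hmin_lab.
by move=> x; rewrite (perm_mem (labels_htree h)); exact: hmin_min.
Qed.

Lemma tree_translation (t : atree) : coloured t -> shuffled t ->
  if tout t == Cg then exists2 a, t = gtree_tree a & gincr a
  else exists2 h, t = htree_tree h & hincr h.
Proof.
elim/tree_nested_ind: t => [[] j _ _|g ts IH] /=; [by exists (Gleaf j)|by exists (Hleaf j)|].
move=> /andP[/eqP gi cs] /andP[so ss].
case: g gi => /=; case: ts IH cs so ss => [|t1 [|t2 [|]]] //=.
- case=> IH _ /andP[c1 _] _ /andP[s1 _] [o1].
  by have := IH c1 s1; rewrite o1 eqxx => -[a -> oa]; exists (Hinj a).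
- case=> IH1 [IH2 _] /and3P[c1 c2 _] /andP[lt _] /and3P[s1 s2 _] [o1 o2].
  have := IH1 c1 s1; have := IH2 c2 s2; rewrite o1 o2 eqxx => -[b eb ob] [a ea oa].
  exists (Gbr a b); rewrite ?ea ?eb //=.
  by rewrite oa ob -(minlab_gtree oa) -(minlab_gtree ob) -ea -eb.
- case=> IH1 [IH2 _] /and3P[c1 c2 _] /andP[lt _] /and3P[s1 s2 _] [o1 o2].
  have := IH1 c1 s1; have := IH2 c2 s2; rewrite o1 o2 eqxx /= => -[h eh oh] [a ea oa].
  exists (Hact a h); rewrite /= ?oa //.
  by rewrite -(minlab_gtree oa) -(minlab_htree oh) -ea -eh lt.
- case=> IH1 [IH2 _] /and3P[c1 c2 _] /andP[lt _] /and3P[s1 s2 _] [o1 o2].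
  have := IH1 c1 s1; have := IH2 c2 s2; rewrite o1 o2 eqxx /= => -[a ea oa] [h eh oh].
  exists (Hact a h); rewrite /= ?oa //.
  by rewrite -(minlab_gtree oa) -(minlab_htree oh) -ea -eh ltnNge (ltnW lt).
Qed.

Lemma leaves_gtree a : leaves (gtree_tree a) = [seq (Cg, j) | j <- glab a].
Proof. by elim: a => //= a IHa b IHb; rewrite cats0 IHa IHb map_cat. Qed.

Lemma leaves_htree_end h j : 0 \notin hlab h ->
  ((Ch, j) \in leaves (htree_tree h)) = (j == hend h) && (j != 0).
Proof.
have notg a : (Ch, j) \in leaves (gtree_tree a) = false.
  by rewrite leaves_gtree; apply/negP => /mapP[].
elim: h => /= [p|a _|a h IH].
- rewrite !inE => p0; rewrite xpair_eqE eqxx /=.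
  by case: eqP => // ->; rewrite eq_sym p0.
- by rewrite cats0 notg; case: eqP => // ->.
- rewrite mem_cat negb_or => /andP[_ h0].
  by case: ifP => _; rewrite /= cats0 mem_cat notg ?orbF IH.
Qed.

(** The coloured leaves determine the end: it is the leaf of colour h, or 0 when there is none. *)
Lemma hend_eq s t : 0 \notin hlab s -> 0 \notin hlab t ->
  perm_eq (leaves (htree_tree s)) (leaves (htree_tree t)) -> hend s = hend t.
Proof.
move=> s0 t0 /perm_mem st.
have [es|es] := eqVneq (hend s) 0.
  have [->//|et] := eqVneq (hend t) 0.
  have := st (Ch, hend t); rewrite !leaves_htree_end // eqxx et andbT.
  by move=> /eqP.
have := st (Ch, hend s); rewrite !leaves_htree_end // eqxx es !andbT.
by move=> /esym/eqP.
Qed.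

Lemma path_word_gtree a x : uniq (glab a) -> x \in glab a ->
  path_word (gtree_tree a) x = gpath a x.
Proof.
elim: a => //= a IHa b IHb u; rewrite mem_cat cats0 !labels_gtree /gpath /=.
have [ua ub] : uniq (glab a) /\ uniq (glab b).
  by move: u; rewrite cat_uniq => /and3P[].
case: ifP => [xa _|_ /= xb]; last by rewrite xb IHb.
by case: ifP => [/(uniq_catP u xa)//|_]; rewrite cats0 IHa.
Qed.

Lemma path_word_htree h x : uniq (hlab h) -> x \in hlab h ->
  path_word (htree_tree h) x = hpath h x.
Proof.
elim: h => //= [a u xa|a h IH u].
  by rewrite cats0 labels_gtree xa path_word_gtree.
have [ua uh] : uniq (glab a) /\ uniq (hlab h).
  by move: u; rewrite cat_uniq => /and3P[].
have D := uniq_catP u.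
rewrite mem_cat => xah; rewrite /act_letter; case: ltnP => _ /=;
  rewrite cats0 labels_gtree (perm_mem (labels_htree h)); congr (_ :: _).
- have [xa|xa] := boolP (x \in glab a).
    by case: ifP => [/(D _ xa)//|_]; rewrite cats0 path_word_gtree.
  by move: xah; rewrite (negbTE xa) /= => xh; rewrite xh IH.
- have [xa|xa] := boolP (x \in glab a).
    by case: ifP => [/(D _ xa)//|_]; rewrite path_word_gtree.
  by move: xah; rewrite (negbTE xa) /= => xh; rewrite xh cats0 IH.
Qed.

Lemma vector_lt_first lemn lebi (p q : nat -> seq affgen) m n :
  path_less lemn lebi (iota m n) p q ->
  vector_lt lemn lebi (map p (iota m n)) (map q (iota m n)).
Proof.
case=> x [xm tie lt]; elim: n m xm tie => // n IH m.
rewrite [iota _ _]/= inE => /orP[/eqP<- _|xm tie] /=; first by rewrite lt.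
have mx : m < x by move: xm; rewrite mem_iota => /andP[].
rewrite tie ?mem_head // eqxx IH ?orbT // => y ym yx.
by apply: tie; rewrite // inE ym orbT.
Qed.

End Translation.

(** * Weights given by graphs *)

Section EdgeWeights.
Variable k : fieldType.

Definition edge_weight (E : rel nat) (x y : nat) : k := (E x y)%:R - (E y x)%:R.

Lemma edge_weight_anti E : antisymmetric_weight (edge_weight E).
Proof. by move=> x y; rewrite /edge_weight opprB. Qed.

Lemma cross_crossing E A B : cross (edge_weight E) A B != 0 -> crossing E A B.
Proof.
move=> c0.
have /hasP[x xA /hasP[y yB e]] : has (fun x => has (fun y => E x y || E y x) B) A.
  apply: contraNT c0 => /hasPn h; rewrite /cross big_seq big1 // => x xA.
  rewrite big_seq big1 // => y yB; have /hasPn/(_ y yB) := h x xA.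
  by rewrite negb_or /edge_weight => /andP[/negbTE-> /negbTE->]; rewrite subrr.
by exists x, y.
Qed.

Lemma val_gcrossed E a :
  treeval (edge_weight E) (gtree_tree a) != 0 -> gcrossed E a.
Proof.
elim: a => //= a IHa b IHb; rewrite !big_cons big_nil mulr1 !pts_gtree.
rewrite !mulf_eq0 !negb_or => /and3P[c va vb].
by split; [exact: IHa|exact: IHb|exact: cross_crossing].
Qed.

Lemma val_hcrossed E h :
  treeval (edge_weight E) (htree_tree h) != 0 -> hcrossed E h.
Proof.
elim: h => //= [a|a h IH].
  rewrite big_seq1 pts_gtree mulf_eq0 negb_or => /andP[c va].
  by split; [exact: val_gcrossed|exact: cross_crossing].
have pc A B : cross (edge_weight E) A (pts (htree_tree h)) = cross (edge_weight E) A (hpts h).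
  by apply: perm_cross => //; exact: pts_htree.
case: ifP => _; rewrite /= !big_cons big_nil mulr1 !pts_gtree.
  rewrite !mulf_eq0 oppr_eq0 !negb_or => /and3P[c va vb].
  split; [exact: val_gcrossed|exact: IH|].
  by apply: cross_crossing; rewrite -(perm_cross _ (perm_refl _) (pts_htree h)).
rewrite !mulf_eq0 !negb_or => /and3P[c va vb].
split; [exact: val_gcrossed|exact: IH|apply: cross_crossing].
rewrite -(perm_cross _ (perm_refl _) (pts_htree h)).
by rewrite cross_anti ?oppr_eq0 //; exact: edge_weight_anti.
Qed.

Lemma cross_single (E : rel nat) A B a b : uniq A -> uniq B ->
  a \in A -> b \in B ->
  {in A & B, forall x y, E x y = (x == a) && (y == b)} ->
  {in A & B, forall x y, E y x = false} ->
  cross (edge_weight E) A B = 1.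
Proof.
move=> uA uB aA bB h h'.
have W x y : x \in A -> y \in B -> edge_weight E x y = ((x == a) && (y == b))%:R.
  by move=> xA yB; rewrite /edge_weight (h x y xA yB) (h' x y xA yB) subr0.
have rest : \sum_(x <- A | x != a) \sum_(y <- B) edge_weight E x y = 0.
  rewrite big_seq_cond big1 // => x /andP[xA /negbTE xa].
  by rewrite big_seq big1 // => y yB; rewrite W // xa.
have row : \sum_(y <- B | y != b) edge_weight E a y = 0.
  by rewrite big_seq_cond big1 // => y /andP[yB /negbTE yb]; rewrite W // yb andbF.
rewrite /cross (bigD1_seq a aA uA) /= rest addr0 (bigD1_seq b bB uB) /= row addr0.
by rewrite W // !eqxx.
Qed.

(** A vertex is crossed by its own edge only, so every factor is 1. The graph [E] is fixed and
    merely agrees with [gedge a] on the labels of [a], which lets the induction pass to subtrees. *)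
Lemma val_gtree_neq0 (E : rel nat) a : uniq (glab a) -> gincr a ->
  {in glab a &, forall x y, E x y = gedge a x y} ->
  treeval (edge_weight E) (gtree_tree a) != 0.
Proof.
elim: a => /= [j _ _ _|a IHa b IHb u /and3P[oa ob ab] h]; first exact: oner_neq0.
have [ua ub] : uniq (glab a) /\ uniq (glab b).
  by move: u; rewrite cat_uniq => /and3P[].
have D := uniq_catP u.
have na x y : x \in glab a -> (gedge b x y = false) * (gedge b y x = false) * (x == grep b = false).
  move=> xa; split; [split|].
  - by apply/negP => /gedge_lab/andP[/(D _ xa)].
  - by apply/negP => /gedge_lab/andP[_ /(D _ xa)].
  - by apply/negP => /eqP xb; apply: (D x); rewrite // xb grep_lab.
have nb x y : x \in glab b -> (gedge a x y = false) * (gedge a y x = false) * (x == grep a = false).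
  move=> xb; split; [split|].
  - by apply/negP => /gedge_lab/andP[/D/(_ xb)].
  - by apply/negP => /gedge_lab/andP[_ /D/(_ xb)].
  - by apply/negP => /eqP xa; apply: (D x); rewrite // xa grep_lab.
rewrite !big_cons big_nil mulr1 !pts_gtree !mulf_neq0 //.
- rewrite (@cross_single E _ _ (grep a) (grep b)) ?oner_neq0 ?grep_lab // => x y xa yb.
    by rewrite h ?mem_cat ?xa ?yb ?orbT // !(na x y xa) !(nb y x yb).
  by rewrite h ?mem_cat ?xa ?yb ?orbT // !(na x y xa) !(nb y x yb).
- apply: IHa => // x y xa ya.
  by rewrite h ?mem_cat ?xa ?ya // !(na x y xa) !(na y x ya) andbF !orbF.
- apply: IHb => // x y xb yb.
  by rewrite h ?mem_cat ?xb ?yb ?orbT // !(nb x y xb) orbF.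
Qed.

Lemma val_htree_neq0 (E : rel nat) h : hnormal h -> uniq (hpts h) ->
  {in hpts h &, forall x y, E x y = hedge h x y} ->
  treeval (edge_weight E) (htree_tree h) != 0.
Proof.
elim: h => /= [p _ _ _|[a|//] _ /andP[a0 _] h|[a|//] h IH nh /andP[an uh] H].
- exact: oner_neq0.
- rewrite big_seq1 mulr1 (@cross_single E _ _ a 0) ?oner_neq0 ?inE // => x y;
    rewrite !inE => /eqP-> /eqP->.
    by rewrite h ?inE ?eqxx ?orbT.
  rewrite h ?inE ?eqxx ?orbT //=; apply: contraNF a0.
  by rewrite inE => /andP[/eqP<-].
- have na y : hedge h a y = false.
    by apply/negP => /hedge_pts/andP[ah]; rewrite ah in an.
  have na' y : hedge h y a = false.
    by apply/negP => /hedge_pts/andP[_ ah]; rewrite ah in an.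
  have ne x : x \in hpts h -> x == a = false.
    by move=> xh; apply: contraNF an => /eqP<-.
  have IHh : treeval (edge_weight E) (htree_tree h) != 0.
    apply: IH => // x y xh yh.
    by rewrite H ?inE ?xh ?yh ?orbT // (ne x) // orbF.
  have C : cross (edge_weight E) [:: a] (hpts h) = 1.
    apply: (@cross_single E _ _ a (hrep h)); rewrite ?inE ?(hlab_pts (hrep_lab h)) // => x y;
      rewrite inE => /eqP-> yh.
      by rewrite H ?inE ?eqxx ?yh ?orbT // na ?eqxx.
    by rewrite H ?inE ?eqxx ?yh ?orbT // na' (ne y).
  case: ifP => _; rewrite /= !big_cons big_nil mulr1 ?mul1r ?mulr1 mulf_neq0 //.
    by rewrite (perm_cross _ (perm_refl _) (pts_htree h)) C oppr_eq0 oner_neq0.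
  rewrite cross_anti; last exact: edge_weight_anti.
  by rewrite (perm_cross _ (perm_refl _) (pts_htree h)) C oppr_eq0 oner_neq0.
Qed.

End EdgeWeights.

(** * Leading terms and reducibility *)

Section Relations.
Variable k : fieldType.
Local Notation atree := (tree AffHS_sig).
Local Notation shtree u := (straighten u).2.

Lemma msupp_sh u t : t \in msupp (sh k u) -> t = shtree u.
Proof. by move=> /(fsubsetP msuppU_le); rewrite inE => /eqP. Qed.

Lemma msupp_sub3 (P : atree -> Prop) u1 u2 u3 :
  P (shtree u1) -> P (shtree u2) -> P (shtree u3) ->
  forall t, t \in msupp (sh k u1 - sh k u2 - sh k u3) -> P t.
Proof.
move=> P1 P2 P3 t /(fsubsetP (msuppB_le _ _)); rewrite inE => /orP[|/msupp_sh->//].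
by move=> /(fsubsetP (msuppB_le _ _)); rewrite inE => /orP[] /msupp_sh->.
Qed.

Lemma msupp_addsub (P : atree -> Prop) u1 u2 u3 :
  P (shtree u1) -> P (shtree u2) -> P (shtree u3) ->
  forall t, t \in msupp (sh k u1 + sh k u2 - sh k u3) -> P t.
Proof.
move=> P1 P2 P3 t /(fsubsetP (msuppB_le _ _)); rewrite inE => /orP[|/msupp_sh->//].
by move=> /(fsubsetP (msuppD_le _ _)); rewrite inE => /orP[] /msupp_sh->.
Qed.

Fixpoint term_ops (u : term) : nat :=
  match u with
  | X _ _ => 0
  | I_ v => (term_ops v).+1
  | Beta v1 v2 | M_ v1 v2 => (term_ops v1 + term_ops v2).+1
  end.

Lemma nvertices_straighten u : nvertices (shtree u) = term_ops u.
Proof.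
elim: u => //= [v|v1 + v2|v1 + v2].
- by case: (straighten v) => e t /= ->; rewrite addn0.
- case: (straighten v1) (straighten v2) => [e1 t1] [e2 t2] /= <- <-.
  by case: ifP => _ /=; rewrite addn0 // addnC.
- case: (straighten v1) (straighten v2) => [e1 t1] [e2 t2] /= <- <-.
  by case: ifP => _ /=; rewrite addn0 // addnC.
Qed.

Lemma AffHS_relation_quadratic : quadratic (@AffHS_relation k).
Proof.
move=> x; case=> s _ t.
- by move: t; apply: msupp_sub3; rewrite nvertices_straighten.
- by move: t; apply: msupp_addsub; rewrite nvertices_straighten.
- by move: t; apply: msupp_addsub; rewrite nvertices_straighten.
Qed.

Lemma perm3_cases (i j l : nat) (Q : nat -> nat -> nat -> Prop) :
  Q 1%N 2%N 3%N -> Q 1%N 3%N 2%N -> Q 2%N 1%N 3%N -> Q 2%N 3%N 1%N ->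
  Q 3%N 1%N 2%N -> Q 3%N 2%N 1%N ->
  perm_eq [:: i; j; l] [:: 1; 2; 3]%N -> Q i j l.
Proof.
move=> q1 q2 q3 q4 q5 q6 p; have := perm_uniq p; have := perm_mem p.
move=> m; have := m i; have := m j; have := m l.
rewrite !inE !eqxx ?orbT /= => /esym/or3P[] /eqP-> /esym/or3P[] /eqP-> /esym/or3P[] /eqP-> //.
Qed.

Lemma AffHS_relation_homogeneous x : AffHS_relation x ->
  exists chi c, @homogeneous k AffHS_sig chi c x.
Proof.
case=> s /= p.
- exists [:: Cg; Cg; Cg], Cg.
  pose Q i j l := homogeneous (S := AffHS_sig) [:: Cg; Cg; Cg] Cg
    (rel_lie k (X Cg i) (X Cg j) (X Cg l)).
  by apply: (perm3_cases (Q := Q) _ _ _ _ _ _ p); apply: msupp_sub3.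
- pose chi l := [:: if l == 1 then Ch else Cg; if l == 2 then Ch else Cg;
                    if l == 3 then Ch else Cg]%N.
  exists (chi (s 3)), Ch.
  pose Q i j l := homogeneous (S := AffHS_sig) (chi l) Ch
    (rel_act k (X Cg i) (X Cg j) (X Ch l)).
  by apply: (perm3_cases (Q := Q) _ _ _ _ _ _ p); apply: msupp_addsub.
- exists [:: Cg; Cg], Ch.
  have [[-> ->]|[-> ->]] : (s 1 = 1 /\ s 2 = 2)%N \/ (s 1 = 2 /\ s 2 = 1)%N.
    have m := perm_mem p; have := m (s 1%N); have := m (s 2%N).
    have := perm_uniq p; rewrite !inE /= !eqxx ?orbT /= !inE andbT.
    by move=> u /esym/orP[] /eqP e2 /esym/orP[] /eqP e1; move: u; rewrite e1 e2 //; auto.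
  by apply: msupp_addsub.
  by apply: msupp_addsub.
Qed.

Section Leading.
Variables (lemn lebi : rel affgen) (le : rel atree).
Hypothesis le_admissible : admissible le.
Hypothesis le_QM : extends_QM lemn lebi le.

(** The other two monomials are strictly smaller, so they cannot cancel [t]. Bounding the support
    through predicates serves both sign patterns of the relations. *)
Lemma leading_first (x : {malg k[atree]}) (t t2 t3 : atree) :
  tree_monomial t -> tree_monomial t2 -> tree_monomial t3 ->
  QM_lt lemn lebi t2 t -> QM_lt lemn lebi t3 t ->
  (forall P : atree -> Prop, P t -> P t2 -> P t3 -> forall s, s \in msupp x -> P s) ->
  (t2 != t -> t3 != t -> x@_t != 0) ->
  leading le x t.
Proof.
move=> m m2 m3 lt2 lt3 supp x0.
have /andP[le2 n2] := le_QM m2 m lt2; have /andP[le3 n3] := le_QM m3 m lt3.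
have [refl _ _ _] := admissible_total le_admissible.
split; first by rewrite -mcoeff_neq0; apply: x0.
by apply: supp => //; exact: refl.
Qed.

Lemma mcoeff_sh u t : (sh k u)@_t = (-1) ^+ (straighten u).1 *+ (shtree u == t).
Proof. exact: mcoeffU. Qed.

Lemma leading_sub3 u1 u2 u3 :
  tree_monomial (shtree u1) -> tree_monomial (shtree u2) -> tree_monomial (shtree u3) ->
  QM_lt lemn lebi (shtree u2) (shtree u1) -> QM_lt lemn lebi (shtree u3) (shtree u1) ->
  leading le (sh k u1 - sh k u2 - sh k u3) (shtree u1).
Proof.
move=> m1 m2 m3 lt2 lt3; apply: (leading_first m1 m2 m3 lt2 lt3).
  by move=> P P1 P2 P3; apply: msupp_sub3.
move=> /negbTE n2 /negbTE n3; rewrite !mcoeffB !mcoeff_sh n2 n3 eqxx !subr0.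
by rewrite mulr1n signr_eq0.
Qed.

Lemma leading_addsub u1 u2 u3 :
  tree_monomial (shtree u1) -> tree_monomial (shtree u2) -> tree_monomial (shtree u3) ->
  QM_lt lemn lebi (shtree u2) (shtree u1) -> QM_lt lemn lebi (shtree u3) (shtree u1) ->
  leading le (sh k u1 + sh k u2 - sh k u3) (shtree u1).
Proof.
move=> m1 m2 m3 lt2 lt3; apply: (leading_first m1 m2 m3 lt2 lt3).
  by move=> P P1 P2 P3; apply: msupp_addsub.
move=> /negbTE n2 /negbTE n3; rewrite mcoeffB mcoeffD !mcoeff_sh n2 n3 eqxx addr0 subr0.
by rewrite mulr1n signr_eq0.
Qed.

Definition reducible (t : atree) : Prop :=
  exists y s, [/\ @AffHS_relation k y, leading le y s & divides s t].

Lemma reducible_child g (ts : seq atree) t :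
  t \in ts -> reducible t -> reducible (Node g ts).
Proof.
move=> tts [y [s [Ry ly [u [sigma [ut us out lt]]]]]].
exists y, s; split=> //; exists u, sigma; split=> //.
by rewrite inE; apply/orP; right; apply/flatten_mapP; exists t.
Qed.

Lemma tout_gtree a : tout (gtree_tree a) = Cg.
Proof. by case: a. Qed.

Lemma tout_htree h : tout (htree_tree h) = Ch.
Proof. by case: h => //= a h; case: ifP. Qed.

Lemma reducible_lie a b c : gincr a -> gincr b -> gincr c ->
  (grep a < grep b)%N -> (grep b < grep c)%N ->
  reducible (gtree_tree (Gbr (Gbr a b) c)).
Proof.
move=> oa ob oc ab bc.
pose x1 := X Cg 1; pose x2 := X Cg 2; pose x3 := X Cg 3.
exists (rel_lie k x1 x2 x3), (shtree (Beta (Beta x1 x2) x3)); split.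
- exact: (@AffHS_lie k id).
(* The comparisons are computations: at the first leaf where the words differ, the numbers of
   letters already decide. *)
- exact: leading_sub3.
- exists (gtree_tree (Gbr (Gbr a b) c)).
  (* Leaves are numbered from 1, so entry 0 is a filler. *)
  exists (nth (gtree_tree a) [:: gtree_tree a; gtree_tree a; gtree_tree b; gtree_tree c]).
  split=> //=; first exact: mem_head.
    by rewrite !tout_gtree.
  by rewrite !minlab_gtree // ab bc.
Qed.

Lemma reducible_act123 a b h : gincr a -> gincr b -> hincr h ->
  (grep a < grep b)%N -> (grep b < hmin h)%N ->
  reducible (htree_tree (Hact (Gbr a b) h)).
Proof.
move=> oa ob oh ab bh.
pose x1 := X Cg 1; pose x2 := X Cg 2; pose x3 := X Ch 3.
exists (rel_act k x1 x2 x3), (shtree (M_ (Beta x1 x2) x3)); split.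
- exact: (@AffHS_act k id).
- exact: leading_addsub.
- rewrite /= (ltn_trans ab bh).
  exists (@Node AffHS_sig Gm [:: gtree_tree (Gbr a b); htree_tree h]).
  exists (nth (gtree_tree a) [:: gtree_tree a; gtree_tree a; gtree_tree b; htree_tree h]).
  split=> //=; first exact: mem_head.
    by rewrite !tout_gtree tout_htree.
  by rewrite !minlab_gtree // minlab_htree // ab bh.
Qed.

Lemma reducible_act132 a b h : gincr a -> gincr b -> hincr h ->
  (grep a < hmin h)%N -> (hmin h < grep b)%N ->
  reducible (htree_tree (Hact (Gbr a b) h)).
Proof.
move=> oa ob oh ah hb.
pose x1 := X Cg 1; pose x2 := X Cg 3; pose x3 := X Ch 2.
exists (rel_act k x1 x2 x3), (shtree (M_ (Beta x1 x2) x3)); split.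
(* The permutation exchanging 2 and 3, again with a filler at 0. *)
- exact: (@AffHS_act k (nth 0 [:: 0; 1; 3; 2])%N).
- exact: leading_addsub.
- rewrite /= ah.
  exists (@Node AffHS_sig Gm [:: gtree_tree (Gbr a b); htree_tree h]).
  (* Entries follow the order of the smallest labels, in which the input of colour h is now
     second. *)
  exists (nth (gtree_tree a) [:: gtree_tree a; gtree_tree a; htree_tree h; gtree_tree b]).
  split=> //=; first exact: mem_head.
    by rewrite !tout_gtree tout_htree.
  by rewrite !minlab_gtree // minlab_htree // ah hb.
Qed.

Lemma reducible_act231 a b h : gincr a -> gincr b -> hincr h ->
  (grep a < grep b)%N -> (hmin h < grep a)%N ->
  reducible (htree_tree (Hact (Gbr a b) h)).
Proof.
move=> oa ob oh ab ha.
pose x1 := X Cg 2; pose x2 := X Cg 3; pose x3 := X Ch 1.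
exists (rel_act k x1 x2 x3), (shtree (M_ (Beta x1 x2) x3)); split.
- exact: (@AffHS_act k (nth 0 [:: 0; 2; 3; 1])%N).
- exact: leading_addsub.
- rewrite /= ltnNge (ltnW ha) /=.
  exists (@Node AffHS_sig Gn [:: htree_tree h; gtree_tree (Gbr a b)]).
  exists (nth (gtree_tree a) [:: gtree_tree a; htree_tree h; gtree_tree a; gtree_tree b]).
  split=> //=; first exact: mem_head.
    by rewrite !tout_gtree tout_htree.
  by rewrite !minlab_gtree // minlab_htree // ab ha.
Qed.

Lemma reducible_aff a b : gincr a -> gincr b -> (grep a < grep b)%N ->
  reducible (htree_tree (Hinj (Gbr a b))).
Proof.
move=> oa ob ab; pose x1 := X Cg 1; pose x2 := X Cg 2.
exists (rel_aff k x1 x2), (shtree (I_ (Beta x1 x2))); split.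
- exact: (@AffHS_aff k id).
- exact: leading_addsub.
- exists (htree_tree (Hinj (Gbr a b))).
  exists (nth (gtree_tree a) [:: gtree_tree a; gtree_tree a; gtree_tree b]).
  split=> //=; first exact: mem_head.
    by rewrite !tout_gtree.
  by rewrite !minlab_gtree // ab.
Qed.

Lemma gnormal_or_reducible a : uniq (glab a) -> gincr a ->
  gnormal a \/ reducible (gtree_tree a).
Proof.
elim: a => /= [|a IHa b IHb u /and3P[oa ob ab]]; first by left.
have [ua ub] : uniq (glab a) /\ uniq (glab b).
  by move: u; rewrite cat_uniq => /and3P[].
case: (IHa ua oa) => [->|ra]; last by right; apply: reducible_child ra; rewrite inE eqxx.
case: (IHb ub ob) => [->|rb]; last by right; apply: reducible_child rb; rewrite !inE eqxx orbT.
case: a u {ua IHa} oa ab => [|a1 a2] u oa ab; first by left.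
have [lt|] := ltnP (grep b) (grep a2); first by left.
rewrite leq_eqVlt => /orP[/eqP e|lt].
  case: (uniq_catP u (x := grep b)); last exact: grep_lab.
  by rewrite -e mem_cat grep_lab orbT.
by have /= /and3P[o1 o2 o12] := oa; right; exact: reducible_lie.
Qed.

Lemma hnormal_or_reducible h : uniq (hlab h) -> hincr h ->
  hnormal h \/ reducible (htree_tree h).
Proof.
elim: h => [p _ _|[a|a b] u o|a h IH]; [by left|by left| |].
  by have /= /and3P[oa ob ab] := o; right; apply: reducible_aff.
move=> u /= /andP[oa oh].
have [ua uh] : uniq (glab a) /\ uniq (hlab h).
  by move: u; rewrite cat_uniq => /and3P[].
case: (IH uh oh) => [->|rh]; last first.
  right; case: ifP => _; apply: reducible_child rh; rewrite !inE eqxx ?orbT //.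
case: a u {ua} oa => [|a b] u oa; first by left.
right; have /= /and3P[o1 o2 o12] := oa.
have D := uniq_catP u.
have hb : hmin h != grep b.
  by apply/eqP => e; apply: (D (grep b)); rewrite -?e ?hmin_lab // e mem_cat grep_lab orbT.
have ha : hmin h != grep a.
  by apply/eqP => e; apply: (D (grep a)); rewrite -?e ?hmin_lab // e mem_cat grep_lab.
(* The place of [hmin h] relative to [grep a < grep b] selects one of the three leading terms of the
   action relation. *)
move: ha hb; rewrite !neq_ltn => /orP[ha _|ha /orP[hb|hb]].
- exact: reducible_act231.
- exact: reducible_act132.
- exact: reducible_act123.
Qed.

End Leading.
End Relations.

(** * Irreducible monomials are not leading terms *)

Section Independence.
Variables (k : fieldType) (lemn lebi : rel affgen) (le : rel (tree AffHS_sig)).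
Hypothesis le_admissible : admissible le.
Hypothesis le_QM : extends_QM lemn lebi le.
Local Notation atree := (tree AffHS_sig).

Lemma QM_lt_path chi c (s t : atree) (p q : nat -> seq affgen) :
  monomial_in chi c s -> monomial_in chi c t ->
  {in labels s, forall x, path_word s x = p x} ->
  {in labels t, forall x, path_word t x = q x} ->
  path_less lemn lebi (labels s) p q -> QM_lt lemn lebi s t.
Proof.
move=> ms mt sp tq less.
have ls := monomial_labels ms; have lt := monomial_labels mt.
have as_ : arity s = size chi by rewrite -(size_iota 1 (size chi)) -(perm_size ls) size_map.
have at_ : arity t = size chi by rewrite -(size_iota 1 (size chi)) -(perm_size lt) size_map.
rewrite /QM_lt /path_vector as_ at_ ltnn eqxx /=; apply: vector_lt_first.
apply: (first_lt_perm (perm_mem ls)).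
have tl x : x \in labels s -> x \in labels t by rewrite (perm_mem ls) (perm_mem lt).
apply: first_lt_mono less => x xs; rewrite (sp x xs) (tq x (tl x xs)) //.
Qed.

(** If [t] were leading, every other term of [x] would have value 0, since one of nonzero value lies
    above [t]; the value of [x] would be the nonzero contribution of [t]. *)
Lemma not_leading (w : nat -> nat -> k) chi c (x : {malg k[atree]}) t :
  antisymmetric_weight w -> AffHS_ideal chi c x ->
  monomial_in chi c t -> treeval w t != 0 ->
  (forall s, monomial_in chi c s -> treeval w s != 0 ->
    s = t \/ QM_lt lemn lebi t s) ->
  ~ leading le x t.
Proof.
move=> aw Ix mt wt above [tx max].
have hom := ideal_gen_homogeneous Ix.
have [_ anti _ _] := admissible_total le_admissible.
have := lval_ideal (@lval_relation k) Ix aw.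
rewrite /lval mmapE (bigD1_seq t tx (fset_uniq _)) /= big_seq_cond big1 ?addr0 => [|s /andP[sx st]].
  by move=> /eqP; rewrite mulf_eq0 (negbTE wt) orbF mcoeff_eq0 tx.
have ms := hom s sx; have [->|ws] := eqVneq (treeval w s) 0; first exact: mulr0.
have [tm sm] : tree_monomial t /\ tree_monomial s by case/and3P: mt; case/and3P: ms.
case: (above s ms ws) => [e|/(le_QM tm sm)/andP[lts nts]]; first by rewrite e eqxx in st.
by case/eqP: nts; apply: anti => //; rewrite lts max.
Qed.

Lemma gnormal_not_leading chi (x : {malg k[atree]}) a : AffHS_ideal chi Cg x ->
  monomial_in chi Cg (gtree_tree a) -> gincr a -> gnormal a ->
  ~ leading le x (gtree_tree a).
Proof.
move=> Ix ma oa na.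
have la := monomial_labels ma; rewrite labels_gtree in la.
have ua : uniq (glab a) by rewrite (perm_uniq la) iota_uniq.
apply: (not_leading (w := edge_weight k (gedge a)) _ Ix ma).
- exact: edge_weight_anti.
- exact: val_gtree_neq0.
move=> s ms ws; have /and3P[/and3P[cs ss _] _ /eqP os] := ms.
have := tree_translation cs ss; rewrite os eqxx => -[b eb ob].
rewrite {}eb {s os cs ss} in ms ws *.
have lb := monomial_labels ms; rewrite labels_gtree in lb.
have ub : uniq (glab b) by rewrite (perm_uniq lb) iota_uniq.
have pab : perm_eq (glab a) (glab b) by rewrite (perm_trans la) // perm_sym.
case: (gnormal_min ua oa ob na pab (val_gcrossed ws)) => [->|less]; first by left.
right; apply: (QM_lt_path (p := gpath a) (q := gpath b) ma ms).
- by move=> y; rewrite labels_gtree; exact: path_word_gtree.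
- by move=> y; rewrite labels_gtree; exact: path_word_gtree.
- by rewrite labels_gtree; exact: gless_path.
Qed.

Lemma hpts_perm h chi c : monomial_in chi c (htree_tree h) ->
  perm_eq (hpts h) (iota 1 (size chi) ++ nseq (phantoms chi c) 0%N).
Proof.
move=> m; rewrite perm_sym; have := pts_htree h; rewrite -(permPl (pts_monomial m)).
by [].
Qed.

(** Labels start at 1 and there is at most one additional point. *)
Lemma uniq_hpts h chi c : monomial_in chi c (htree_tree h) -> uniq (hpts h).
Proof.
move=> m; rewrite (perm_uniq (hpts_perm m)) cat_uniq iota_uniq /=.
have : (phantoms chi c <= 1)%N.
  by rewrite /phantoms (leq_trans (leq_subr _ _)) // leq_b1.
by case: (phantoms chi c) => [|[|]] //= _; rewrite mem_iota.
Qed.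

Lemma hnormal_not_leading chi (x : {malg k[atree]}) h : AffHS_ideal chi Ch x ->
  monomial_in chi Ch (htree_tree h) -> hincr h -> hnormal h ->
  ~ leading le x (htree_tree h).
Proof.
move=> Ix mh oh nh.
have uh := uniq_hpts mh.
have h0 : 0%N \notin hlab h.
  by rewrite -(perm_mem (labels_htree h)) (labels_monomial_neq0 mh).
have ulab g : monomial_in chi Ch (htree_tree g) -> uniq (hlab g).
  move=> mg; rewrite -(perm_uniq (labels_htree g)).
  by rewrite (perm_uniq (monomial_labels mg)) iota_uniq.
apply: (not_leading (w := edge_weight k (hedge h)) _ Ix mh).
- exact: edge_weight_anti.
- exact: val_htree_neq0.
move=> s ms ws; have /and3P[/and3P[cs ss _] _ /eqP os] := ms.
have := tree_translation cs ss; rewrite os /= => -[g eg og].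
rewrite {}eg {s os cs ss} in ms ws *.
have g0 : 0%N \notin hlab g.
  by rewrite -(perm_mem (labels_htree g)) (labels_monomial_neq0 ms).
have phg : perm_eq (hpts h) (hpts g).
  by rewrite (perm_trans (hpts_perm mh)) // perm_sym; exact: hpts_perm.
have ends : hend h = hend g.
  apply: hend_eq => //; case/and3P: mh => _ ph _; case/and3P: ms => _ pg _.
  by rewrite (perm_trans ph) // perm_sym.
case: (hnormal_min lemn lebi uh h0 g0 nh og phg ends (val_hcrossed ws)) => [->|less].
  by left.
right; apply: (QM_lt_path (p := hpath h) (q := hpath g) mh ms).
- move=> y; rewrite (perm_mem (labels_htree h)); apply: path_word_htree; exact: ulab.
- move=> y; rewrite (perm_mem (labels_htree g)); apply: path_word_htree; exact: ulab.
- by apply: first_lt_perm less => y; rewrite (perm_mem (labels_htree h)).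
Qed.

End Independence.

Theorem theorem4p5 (k : fieldType) (char0 : [pchar k] =i pred0)
    (lemn lebi : rel affgen)
    (lemn_total : total_order_on in_mn lemn)
    (lebi_total : total_order_on in_bi lebi)
    (le : rel (tree AffHS_sig))
    (le_admissible : admissible le)
    (le_QM : extends_QM lemn lebi le) :
  exists G : {malg k[tree AffHS_sig]} -> Prop,
    groebner_basis le (@AffHS_ideal k) G /\ quadratic G.
Proof.
exists (@AffHS_relation k); split; last exact: AffHS_relation_quadratic.
split.
  split=> // x Rx; have [chi [c hom]] := AffHS_relation_homogeneous Rx.
  by exists chi, c; apply: ideal_gen_base.
move=> chi c x t Ix _ lead.
have mt := ideal_gen_homogeneous Ix lead.1.
have /and3P[/and3P[ct st _] _ /eqP ot] := mt.
have := tree_translation ct st; case: eqP => [oc [a et oa]|/eqP oc [h et oh]];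
  rewrite et in mt lead ot *.
  have ec : c = Cg by rewrite -ot -et oc.
  rewrite ec in Ix mt.
  have ua : uniq (glab a).
    by rewrite -labels_gtree (perm_uniq (monomial_labels mt)) iota_uniq.
  case: (gnormal_or_reducible k le_admissible le_QM ua oa) => // na.
  by case: (gnormal_not_leading le_admissible le_QM Ix mt oa na lead).
have ec : c = Ch by case: c {Ix mt} ot oc => // e; rewrite et e.
rewrite ec in Ix mt.
have uh : uniq (hlab h).
  rewrite -(perm_uniq (labels_htree h)).
  by rewrite (perm_uniq (monomial_labels mt)) iota_uniq.
case: (hnormal_or_reducible k le_admissible le_QM uh oh) => // nh.
by case: (hnormal_not_leading le_admissible le_QM Ix mt oh nh lead).
Qed.
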